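(* Let $G$ be a finite group, $H$ a normal subgroup of prime index $p$, $a\in G\setminus H$, $\mathbb{F}$ a field, and $V$ a $G$-stable irreducible $\mathbb{F}H$-module with $\mathbb{F}$-basis $e_0,\dots,e_{d-1}$, representation $\sigma\colon H\to\mathrm{GL}(V)$ and division algebra $\Delta=\mathrm{End}_{\mathbb{F}H}(V)$. Let $\alpha\in\mathrm{Aut}_{\mathbb{F}}(V)$ satisfy $(aha^{-1})\sigma=\alpha(h\sigma)\alpha^{-1}$ for all $h\in H$, and put $\lambda=\alpha^{-p}(a^p\sigma)\in\Delta^\times$. Suppose that $\alpha$ induces an inner automorphism of $\Delta$: there is $\varepsilon\in\Delta^\times$ with $\alpha^{-1}\delta\alpha=\varepsilon^{-1}\delta\varepsilon$ for all $\delta\in\Delta$. Set $\eta=\varepsilon^p\lambda$ and let $\xi,\omega\in\Delta$ satisfy $\xi^p=\eta$ and $\omega^p=1$. Then $\xi\in Z=Z(\Delta)$, the centre of $\Delta$. Moreover: (a) If $\mathrm{char}(\mathbb{F})\ne p$ and $\omega\ne1$, then $V{\uparrow}$ is an internal direct sum $$V{\uparrow}=U(\xi)\dotplus U(\xi\omega)\dotplus\cdots\dotplus U(\xi\omega^{p-1}),\qquad\text{where}\qquad U(\xi\omega^j)=V\sum_{i=0}^{p-1}(\xi\omega^j)^{-i}\varepsilon^i\alpha^{-i}a^i$$ is irreducible; and, for $\omega'\in\Delta$ with $\omega'^p=1$, $U(\xi\omega)\cong U(\xi\omega')$ if and only if $\omega$ and $\omega'$ are conjugate in $\Delta$. If $\mu(s)$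 is a (monic) irreducible factor of $s^p-\eta$ in $Z[s]$, then $W_\mu$ (defined in the context) is a Wedderburn component of $V{\uparrow}$, and $W_\mu=U(\theta_1)\dotplus\cdots\dotplus U(\theta_n)$ where $\theta_1,\dots,\theta_n$ are the roots of $\mu(s)$ in the field $Z(\xi,\omega)$. In addition, for $\theta=\xi\omega^j$, the representation $\rho_\theta\colon G\to\mathrm{GL}(U(\theta))$ afforded by $U(\theta)$ relative to the basis $e'_0,\dots,e'_{d-1}$, where $e'_k=e_k\sum_{i=0}^{p-1}\theta^{-i}\varepsilon^i\alpha^{-i}a^i$, satisfies $$a\rho_\theta=\alpha\varepsilon^{-1}\theta\qquad\text{and}\qquad h\rho_\theta=h\sigma\quad(h\in H),$$ and $\mathrm{End}_{\mathbb{F}G}(U(\theta))=C_\Delta(\theta)$. (b) If $\mathrm{char}(\mathbb{F})=p$, then $\omega=1$ and $V{\uparrow}$ is uniserial with unique composition series $\{0\}=W_0\subset W_1\subset\cdots\subset W_p=V{\uparrow}$, where $$W_k=\sum_{i=1}^kV\sum_{j=0}^{p-i}\binom{i+j-1}{j}\xi^{-j}\varepsilon^j\alpha^{-j}a^j.$$ Moreover, $W_k/W_{k-1}\cong U(\xi)$ for $k=1,\dots,p$, and $\mathrm{End}_{\mathbb{F}G}(U(\xi))=\Delta$.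
   Context: Conventions: modules are right modules; linear maps are written on the right and composed from left to right (so $v(\varphi\psi)=(v\varphi)\psi$), and matrices act on row vectors from the right, so endomorphism algebras are identified with algebras of matrices under matrix multiplication. $\sigma$ is the representation with $vh=v(h\sigma)$. $V$ is $G$-stable if for each $g\in G$ the representation $h\mapsto(ghg^{-1})\sigma$ of $H$ is equivalent to $\sigma$; this guarantees that some $\alpha$ as in the claim exists. $V{\uparrow}=V\otimes_{\mathbb{F}H}\mathbb{F}G$ is the induced module. Write $va^i$ for $v\otimes a^i\in V{\uparrow}$; for $\beta_i\in\mathrm{End}_{\mathbb{F}}(V)$, $v\sum_i\beta_ia^i$ means $\sum_i(v\beta_i)\otimes a^i$, and $V\sum_i\beta_ia^i=\{v\sum_i\beta_ia^i\mid v\in V\}$. One has $\lambda\in\Delta^\times$, $\alpha^{-1}\lambda\alpha=\lambda$ and $\alpha^{-p}\delta\alpha^p=\lambda\delta\lambda^{-1}$ for $\delta\in\Delta$, which gives $\eta\in Z(\Delta)^\times$. $U(\theta)$ denotes $V\sum_{i=0}^{p-1}\theta^{-i}\varepsilon^i\alpha^{-i}a^i$ for $\theta\in\Delta$ with $\theta^p=\eta$, and $C_\Delta(\theta)$ is the centralizer of $\theta$ in $\Delta$; $\mathrm{End}_{\mathbb{F}G}(U(\theta))$ is described as matrices relative to the basis $e'_0,\dots,e'_{d-1}$. Definition of $W_\mu$: let $\Delta[s]$ be the polynomial ring over $\Delta$ in a central indeterminate $s$. If $s^p-\eta=\nu(s)\mu(s)$ with $\mu(s)$ and $\nu(s)=\sum_{j=0}^{p-m}\nu_js^j$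 monic in $\Delta[s]$ and $m=\deg\mu$, then $$W_\mu=\sum_{i=0}^{m-1}V\sum_{j=0}^{p-m}\nu_j\varepsilon^{i+j}\alpha^{-(i+j)}a^{i+j},$$ which is an $\mathbb{F}G$-submodule of $V{\uparrow}$. A Wedderburn component of a semisimple module is a homogeneous (isotypic) component, i.e. the sum of all simple submodules isomorphic to a given one.
   Formalization: When char(F) = 0 it is additionally assumed that ξ lies in Z(Δ), since ξ ∈ Z can fail there (e.g. Δ the rational quaternions, p = 3, η = 1, ξ a noncentral cube root of 1); in positive characteristic ξ ∈ Z is proved. *)

(* Defs.v *)
From HB Require Import structures.
From mathcomp Require Import all_boot all_order all_fingroup all_algebra.
From mathcomp Require Import all_solvable all_field all_character.

Set Implicit Arguments.
Unset Strict Implicit.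
Unset Printing Implicit Defensive.

Import GRing.Theory.

Local Open Scope ring_scope.

(* The induced module V (x)_{FH} FG, where V = 'rV_n is the module of rV and  *)
(* FG is 'rV_#|G|, the regular module.  V (x)_F FG is 'M_(n, #|G|), flattened *)
(* by mxvec, with v (x) u the matrix v^T *m u; the tensor product over FH is  *)
(* its quotient by the span of all  v h (x) x - v (x) h x.                    *)
Section Induced.

Variables (F : fieldType) (gT : finGroupType) (G H : {group gT}).
Hypothesis sHG : H \subset G.
Variables (n : nat) (rV : mx_representation F H n).
Local Notation aG := (regular_repr F G).

Definition tensF_mx (g : gT) : 'M[F]_(n * #|G|) := lin_mulmxr (aG g).

Lemma tensF_mx_repr : mx_repr G tensF_mx.
Proof.
split=> [|x y Gx Gy]; apply/row_matrixP=> i; rewrite !rowE.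
  by rewrite -(vec_mxK (delta_mx 0 i)) mul_vec_lin /= repr_mx1 !mulmx1.
rewrite mulmxA -(vec_mxK (delta_mx 0 i)) !mul_vec_lin /=.
by rewrite repr_mxM // mulmxA.
Qed.
Canonical tensF_repr := MxRepresentation tensF_mx_repr.

(* The matrix of v |-> v (x) x, V -> V (x)_F FG. *)
Definition tensF (x : gT) : 'M[F]_(n, n * #|G|) :=
  lin1_mx (mxvec \o mulmxr (gring_row (aG x)) \o trmx).

Definition tens_rel : 'M[F]_(n * #|G|) :=
  (\sum_(h in H) \sum_(x in G) <<(rV h *m tensF x - tensF (h * x)%g)%R>>)%MS.

Lemma tensFM x g : x \in G -> g \in G ->
  tensF x *m tensF_repr g = tensF (x * g)%g.
Proof.
move=> Gx Gg; apply/row_matrixP=> i; rewrite row_mul !rowE !mul_rV_lin1 /=.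
by rewrite mxvecK -mulmxA -gring_row_mul -(repr_mxM aG).
Qed.

Lemma tens_rel_module : mxmodule tensF_repr tens_rel.
Proof.
apply/mxmoduleP=> g Gg; rewrite sumsmxMr; apply/sumsmx_subP=> h Hh.
have Gh := subsetP sHG h Hh.
rewrite (submx_trans _ (sumsmx_sup h Hh (submx_refl _))) //.
rewrite sumsmxMr; apply/sumsmx_subP=> x Gx.
rewrite (eqmxMr _ (genmxE _)) (sumsmx_sup (x * g)%g) ?groupM // genmxE.
by rewrite mulmxBl -mulmxA !tensFM ?groupM // mulgA.
Qed.

Definition ind_dim : nat := \rank (cokermx tens_rel).

Definition ind_repr : mx_representation F G ind_dim :=
  factmod_repr tens_rel_module.

(* The matrix of v |-> v (x) x, V -> V (x)_{FH} FG. *)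
Definition tens (x : gT) : 'M[F]_(n, ind_dim) :=
  in_factmod tens_rel (tensF x).

Lemma tens_midlin h x : h \in H -> x \in G -> tens (h * x)%g = rV h *m tens x.
Proof.
move=> Hh Gx; apply/esym/eqP; rewrite /tens /in_factmod /= mulmxA -subr_eq0.
rewrite -mulmxBl -[_ *m col_base _]/(in_factmod _ _) in_factmod_eq0.
by rewrite (sumsmx_sup h) // (sumsmx_sup x) // genmxE.
Qed.

Lemma tensM x g : x \in G -> g \in G -> tens x *m ind_repr g = tens (x * g)%g.
Proof. by move=> Gx Gg; rewrite -in_factmodJ // tensFM. Qed.

End Induced.

Section EndomorphismAlgebra.

Variables (F : fieldType) (gT : finGroupType) (G : {group gT}) (n : nat).
Variable rG : mx_representation F G n.

Definition endalg : {pred 'M[F]_n} :=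
  [pred f | (f \in 'C(enveloping_algebra_mx rG))%MS].

Definition endcenter : {pred 'M[F]_n} :=
  [pred f | (f \in 'Z('C(enveloping_algebra_mx rG)))%MS].

End EndomorphismAlgebra.

Definition G_stable (F : fieldType) (gT : finGroupType) (G H : {group gT})
    (n : nat) (rV : mx_representation F H n) : Prop :=
  forall g, g \in G ->
    exists2 rVg : mx_representation F H n,
      forall h, h \in H -> rVg h = rV (g * h * g^-1)%g & mx_rsim rVg rV.

(* Irreducibility in Z[s], for a subset Z of R that is a field; the units of  *)
(* Z[s] are then the polynomials of size 1.                                   *)
Definition irreducible_over (R : nzRingType) (Z : {pred R}) (mu : {poly R}) :=
  [/\ mu \is a polyOver Z, (1 < size mu)%N
    & forall q r : {poly R}, q \is a polyOver Z -> r \is a polyOver Z ->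
        mu = q * r -> size q = 1%N \/ size r = 1%N].

(* Membership in Z(x, y), the least division subring containing Z, x and y. *)
Definition in_adjoin2 (R : unitRingType) (Z : {pred R}) (x y z : R) : Prop :=
  forall S : {pred R}, divring_closed S -> {subset Z <= S} ->
    x \in S -> y \in S -> z \in S.

(* B is the matrix whose rows are the basis of a submodule of rG, and rB is   *)
(* the representation afforded by that submodule relative to this basis.      *)
Definition affords (F : fieldType) (gT : finGroupType) (G : {group gT})
    (N n : nat) (rG : mx_representation F G N) (B : 'M[F]_(n, N))
    (rB : mx_representation F G n) : Prop :=
  row_free B /\ forall g, g \in G -> B *m rG g = rB g *m B.

Definition uniserial (F : fieldType) (gT : finGroupType) (G : {group gT})
    (N : nat) (rG : mx_representation F G N) : Prop :=
  forall U W : 'M[F]_N, mxmodule rG U -> mxmodule rG W ->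
    (U <= W)%MS \/ (W <= U)%MS.

Section Submodules.

Variables (F : fieldType) (gT : finGroupType) (G H : {group gT}).
Hypothesis sHG : H \subset G.
Variables (n : nat) (rV : mx_representation F H n.+1).
Variables (p : nat) (a : gT) (alpha eps : 'M[F]_n.+1).
Local Notation N := (ind_dim G rV).
Local Notation va i := (tens G rV (a ^+ i)%g).

(* Row k is the vector  e_k \sum_i theta^-i eps^i alpha^-i a^i. *)
Definition Ubasis (theta : 'M[F]_n.+1) : 'M[F]_(n.+1, N) :=
  \sum_(i < p) (theta ^- i * eps ^+ i * alpha ^- i) *m va i.

Definition Usub (theta : 'M[F]_n.+1) : 'M[F]_N := <<Ubasis theta>>%MS.

Definition Wsub (mu nu : {poly 'M[F]_n.+1}) : 'M[F]_N :=
  let m := (size mu).-1 in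
  (\sum_(i < m)
     <<(\sum_(j < (p - m).+1)
          (nu`_j * eps ^+ (i + j) * alpha ^- (i + j)) *m va (i + j)%N)%R>>)%MS.

Definition Wseries (xi : 'M[F]_n.+1) (k : nat) : 'M[F]_N :=
  (\sum_(1 <= i < k.+1)
     <<(\sum_(0 <= j < (p - i).+1)
          ('C(i + j - 1, j)%:R * xi ^- j * eps ^+ j * alpha ^- j)
            *m va j)%R>>)%MS.

End Submodules.

(* Main.v *)
(*   Put b_i = eps^i alpha^-i a^i.  The b_i, i < p, are a Delta-basis of the  *)
(* FH-homomorphisms V -> V^, and b_i a = gamma b_(i+1) for the matrix gamma = *)
(* alpha eps^-1, which commutes with Delta, while b_p = eta b_0; so these     *)
(* homomorphisms form the left Delta[s]-module Delta[s]/(s^p - eta), with s   *)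
(* acting by X |-> gamma^-1 X a.  As V^ is homogeneous over H, its submodules *)
(* are the left ideals of this quotient.                                      *)
(*   If char F != p, then s^p - eta is the product of the s - xi omega^j, and *)
(* U(xi omega^j) is the image of the homomorphism that s multiplies by        *)
(* xi omega^j.  Maps between these modules are the d in Delta such that       *)
(* theta d = d theta'; the roots of an irreducible factor mu are conjugate in *)
(* Delta by a Skolem-Noether argument, and a d intertwining theta and theta'  *)
(* carries a root of mu to a root of mu.                                      *)
(*   If char F = p, then s^p - eta = (s - xi)^p, so that the submodules form  *)
(* a chain.                                                                   *)
(*   When char F > 0, xi is central because Delta is commutative: the span A  *)
(* of sigma(H) over the prime field is a finite semiprime ring, so it has an  *)
(* idempotent e such that eAe is a field by Wedderburn's little theorem; then *)
(* the commutative ring F(eAe) acts transitively on Ve, where Delta acts      *)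
(* faithfully and commutes with it.                                           *)

From HB Require Import structures.
From Stdlib Require Import Classical_Prop.
Require Import Defs.
From mathcomp Require Import all_boot all_order all_fingroup all_algebra.
From mathcomp Require Import all_solvable all_field all_character.

Set Implicit Arguments.
Unset Strict Implicit.
Unset Printing Implicit Defensive.

Import GRing.Theory.
Local Open Scope ring_scope.

(** The sections below work with an abstract family of FH-homomorphisms b_i from V, with dual
    coordinates c_i, such that b_i a = gamma b_(i+1) and b_p = xi^p b_0; [tbasis] and [tcoord]
    realize it on the induced module. By [Hhom_generates] a submodule is determined by the
    FH-homomorphisms into it, so everything reduces to linear algebra over Delta with the cyclic
    operator s : X |-> gamma^-1 X a. If s X = theta X with X nonzero, the image of X is a copy of V
    on which [a] acts by gamma theta. This one observation yields simplicity, the afforded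
    representation and its endomorphism ring ([Hhom_simpleG], [extension_exists],
    [extension_endalg]).

    When char F is not p, s has the p distinct eigenvalues xi omega^l, and a discrete Fourier
    transform passes from the b_i to the eigenvectors [uvec] ([uvec_ucoord], [sum_ucoord]).
    Isomorphisms between their images are conjugations of eigenvalues inside Delta ([uvec_iso]).
    Evaluating nu(s) at the eigenvalues shows that W_mu collects exactly the eigenvectors whose
    eigenvalue is a root of mu ([Wpoly_roots]), and [conjugate_roots] puts them in one isomorphism
    class.

    When char F = p, the operator 1 - xi^-1 s is a single nilpotent Jordan block in the basis [wvec]
    ([nabla_wvec1], [nabla_wvecS]). Hence the initial segments of that basis span the only
    submodules ([module_wsum]), and the composition series is forced.

    Centrality of xi is the hypothesis [xiZ0] in characteristic 0; in positive characteristic it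
    comes from [pchar_centgmx_comm]. *)

(** * Coordinates on the induced module along the transversal 1, a, ..., a^(p-1) *)

Section InducedBasis.

Variables (F : fieldType) (gT : finGroupType) (G H : {group gT}).
Hypothesis nHG : (H <| G)%g.
Variable p : nat.
Hypotheses (p_pr : prime p) (indexHG : #|G : H|%g = p).
Variable a : gT.
Hypotheses (aG : a \in G) (aNH : a \notin H).
Variables (n : nat) (rV : mx_representation F H n).
Let sHG := normal_sub nHG.
Local Notation Vup := (ind_repr sHG rV).
Local Notation N := (ind_dim G rV).
Local Notation va i := (tens G rV (a ^+ i)%g).

(** The quotient G/H has prime order p and the coset of [a] is not trivial, so that coset has order
    exactly p. *)
Lemma expg_transversal i : (a ^+ i \in H)%g -> (p %| i)%N.
Proof.
have Na : a \in 'N(H)%g by apply: (subsetP (normal_norm nHG)).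
have o_a : #[coset H a]%g = p.
  apply/eqP; have /primeP[_] := p_pr; move=> /(_ #[coset H a]%g).
  rewrite -indexHG -card_quotient ?normal_norm //.
  rewrite order_dvdG ?mem_quotient // => /(_ isT)/orP[|//].
  by rewrite order_eq1 => /eqP/coset_idr-/(_ Na) aH; case/negP: aNH.
move=> aiH; rewrite -o_a order_dvdn -morphX //=.
by rewrite coset_id.
Qed.

Lemma expg_transversal_inj (i j : 'I_p) h k :
  h \in H -> k \in H -> (h * a ^+ i = k * a ^+ j)%g -> i = j.
Proof.
wlog le_ij: i j h k / (i <= j)%N => [IH|] hH kH eq_hk.
  have [le_ij|/ltnW le_ji] := leqP i j; first exact: (IH _ _ h k).
  by apply/esym; apply: (IH _ _ k h).
apply/val_inj/eqP => /=; rewrite eqn_leq le_ij /=.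
have: (a ^+ (j - i) \in H)%g.
  have -> : (a ^+ (j - i) = k^-1 * h)%g.
    apply: (mulIg (a ^+ i)%g); rewrite -expgD subnK //.
    by rewrite -mulgA eq_hk mulKg.
  by rewrite groupM ?groupV.
move/expg_transversal; case: (posnP (j - i)) => [/eqP|ji_gt0 /dvdn_leq].
  by rewrite subn_eq0.
move/(_ ji_gt0); rewrite leqNgt (leq_ltn_trans (leq_subr _ _)) //.
Qed.

Lemma expg_transversal_cover :
  [set (z.2 * a ^+ z.1)%g | z : 'I_p * gT in setX [set: 'I_p] H] = G.
Proof.
apply/eqP; rewrite eqEcard card_in_imset.
  apply/andP; split; last by rewrite cardsX cardsT card_ord -indexHG mulnC Lagrange.
  apply/subsetP=> x /imsetP[[i h]]; rewrite inE /= => /andP[_ hH] ->.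
  by rewrite groupM ?groupX // (subsetP sHG).
move=> [i h] [j k]; rewrite !inE /= => hH kH eq_hk.
have eq_ij := expg_transversal_inj hH kH eq_hk.
by move: eq_hk; rewrite eq_ij => /mulIg->.
Qed.

(** G is generated by H and [a]. Later sections assume this principle as [G_ind] and thus check
    actions on H and on [a] only. *)
Lemma normal_cyclic_ind (Q : gT -> Prop) :
    (forall h, h \in H -> Q h) -> Q a ->
    (forall x y, x \in G -> y \in G -> Q x -> Q y -> Q (x * y)%g) ->
  forall g, g \in G -> Q g.
Proof.
move=> QH Qa QM g; rewrite -expg_transversal_cover.
case/imsetP=> -[i h]; rewrite inE /= => /andP[_ hH] ->.
apply: (QM _ _ _ _ (QH h hH)); [exact: (subsetP sHG) | exact: groupX |].
elim: {i}(i : nat) => [|i IHi]; first by apply: QH; apply: group1.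
by rewrite expgS; apply: QM => //; rewrite groupX.
Qed.

Lemma sum_rcosets (R : nmodType) (f : gT -> R) :
  \sum_(x in G) f x = \sum_(i < p) \sum_(h in H) f (h * a ^+ i)%g.
Proof.
rewrite pair_big_dep /=.
pose D := [set (z.2 * a ^+ z.1)%g | z : 'I_p * gT in setX [set: 'I_p] H].
transitivity (\sum_(x in D) f x).
  by apply: eq_bigl => x; rewrite /D expg_transversal_cover.
rewrite big_imset /=; first by apply: eq_bigl => z; rewrite inE in_setT.
move=> [i h] [j k]; rewrite !inE /= => hH kH eq_hk.
have eq_ij := expg_transversal_inj hH kH eq_hk.
by move: eq_hk; rewrite eq_ij => /mulIg->.
Qed.

(* The coefficient of the group element x, on V (x)_F FG. *)
Definition tensF_coef (x : gT) : 'M[F]_(n * #|G|, n) :=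
  lin1_mx (trmx \o col (gring_index G x) \o vec_mx).

Lemma gring_row_regular x : x \in G ->
  gring_row (regular_repr F G x) = delta_mx 0 (gring_index G x).
Proof. by move=> Gx; rewrite /gring_row rowK gring_indexK // mul1g. Qed.

Lemma tensF_coefK x y : x \in G -> y \in G ->
  tensF F G n x *m tensF_coef y = (x == y)%:R%:M.
Proof.
move=> Gx Gy; apply/row_matrixP=> i; rewrite !row_mul !rowE.
rewrite !mul_rV_lin1 /= mxvecK gring_row_regular // trmx_delta.
rewrite mul_mx_scalar; apply/rowP=> j; rewrite !mxE big_ord1 !mxE !eqxx.
rewrite -(inj_eq (can_inj (@gring_valK _ G))) !gring_indexK //= andbT.
by rewrite eq_sym (eq_sym y) mulrC.
Qed.

Lemma sum_tensF_coef : \sum_(x in G) tensF_coef x *m tensF F G n x = 1%:M.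
Proof.
apply/row_matrixP=> i; rewrite -[row i 1%:M]vec_mxK; set M := vec_mx _.
rewrite row1 in M *; rewrite rowE -[delta_mx 0 i]vec_mxK mulmx_sumr.
rewrite -/M.
under eq_bigr => x Gx.
  rewrite mulmxA mul_rV_lin1 /= mul_rV_lin1 /= mxvecK trmxK.
  rewrite gring_row_regular //.
  over.
rewrite -linear_sum /=; congr mxvec; apply/matrixP=> j k.
rewrite summxE (bigD1 (enum_val k)) ?enum_valP //= big1 => [|x /andP[Gx nxk]].
  rewrite addr0 gring_valK !mxE big_ord1 !mxE !eqxx mulr1 //.
rewrite !mxE big_ord1 !mxE eqxx /= -(inj_eq (@enum_val_inj _ _)).
by rewrite gring_indexK // [enum_val k == x]eq_sym (negPf nxk) mulr0.
Qed.

(** A class is lifted to V (x)_F FG by the section [val_factmod 1%:M]; then v (x) h a^i is sent to v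
    h, and the other cosets of H to 0. *)
Definition ind_coord (i : nat) : 'M[F]_(N, n) :=
  val_factmod 1%:M
    *m \sum_(h in H) tensF_coef (h * a ^+ i)%g *m rV h.

(** The choice of the lift is immaterial: v h (x) x and v (x) h x have the same image, both being 0
    unless x lies in the coset H a^i, so the map kills the tensor relations. *)
Lemma in_factmod_coord i m (A : 'M[F]_(m, n * #|G|)) (i_lt_p : (i < p)%N) :
  in_factmod (tens_rel G rV) A *m ind_coord i
    = A *m \sum_(h in H) tensF_coef (h * a ^+ i)%g *m rV h.
Proof.
set K := \sum_(h in H) _.
have tensK x : x \in G -> tensF F G n x *m K =
    (if (x * a ^- i)%g \in H then rV (x * a ^- i)%g else 0).
  move=> Gx; rewrite /K mulmx_sumr.
  under eq_bigr => h Hh.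
    rewrite mulmxA tensF_coefK ?groupM ?groupX ?(subsetP sHG h) //.
    rewrite mul_scalar_mx eq_sym.
    have -> : (h * a ^+ i == x)%g = (h == x * a ^- i)%g.
      by rewrite -(inj_eq (mulIg (a ^- i)%g)) mulgK.
    over.
  case: ifP => xH; last first.
    rewrite big1 // => h Hh; case: eqP => [eq_h|]; last by rewrite scale0r.
    by rewrite -eq_h Hh in xH.
  rewrite (bigD1 (x * a ^- i)%g) //= eqxx scale1r big1 ?addr0 // => h.
  by case/andP=> _ /negPf->; rewrite scale0r.
have relK : (tens_rel G rV <= kermx K)%MS.
  apply/sumsmx_subP=> h Hh; apply/sumsmx_subP=> x Gx; rewrite genmxE.
  have Gh := subsetP sHG h Hh.
  apply/sub_kermxP; rewrite mulmxBl -mulmxA (tensK x Gx).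
  rewrite (tensK (h * x)%g (groupM Gh Gx)) -mulgA (groupMl _ Hh).
  have [xH|xH] := boolP (x * a ^- i \in H)%g; last by rewrite mulmx0 subr0.
  by rewrite (repr_mxM rV Hh xH) subrr.
rewrite /ind_coord mulmxA -val_factmodE.
rewrite -[in RHS](add_sub_fact_mod (tens_rel G rV) A) mulmxDl.
set X := val_submod _; have /sub_kermxP -> : (X <= kermx K)%MS.
  exact: submx_trans (val_submodP _) relK.
by rewrite add0r.
Qed.

Lemma tens_coord (i j : 'I_p) : va i *m ind_coord j = (i == j)%:R%:M.
Proof.
rewrite in_factmod_coord // mulmx_sumr.
under eq_bigr => h Hh.
  rewrite mulmxA tensF_coefK ?groupM ?groupX ?(subsetP sHG h) //.
  rewrite mul_scalar_mx; over.
have [<-|neq_ij] := eqVneq i j.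
  rewrite (bigD1 1%g) //= mul1g eqxx scale1r repr_mx1 big1 ?addr0 // => h.
  case/andP=> _ nh1; case: eqP => [eq_h|]; last by rewrite scale0r.
  by case/eqP: nh1; apply: (mulIg (a ^+ i)%g); rewrite mul1g -eq_h.
rewrite big1 => [|h Hh]; first by rewrite raddf0.
case: eqP => [eq_h|]; last by rewrite scale0r.
case/eqP: neq_ij; apply: (@expg_transversal_inj _ _ 1%g h) => //.
by rewrite mul1g.
Qed.

Lemma sum_coord_tens : \sum_(i < p) ind_coord i *m va i = 1%:M.
Proof.
under eq_bigr => i _.
  rewrite /ind_coord -mulmxA mulmx_suml.
  under eq_bigr => h Hh.
    rewrite -mulmxA -tens_midlin ?groupX // /tens /in_factmod /= mulmxA.
    over.
  over.
rewrite -mulmx_sumr -(sum_rcosets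
  (fun x => tensF_coef x *m tensF F G n x *m col_base (cokermx (tens_rel G rV)))).
rewrite -mulmx_suml sum_tensF_coef mul1mx.
exact: (@val_factmodK _ _ (tens_rel G rV) _ 1%:M).
Qed.

End InducedBasis.

(** * Commutative corners of finite semiprime rings *)

(** Wedderburn's little theorem. The identity [e] of [t] may differ from that of [M], so [t] is not
    a subring; a fresh ring structure is built on [seq_sub t]. *)
Lemma finite_division_comm (M : nzRingType) (t : seq M) (e : M) :
    e \in t -> e != 0 ->
    {in t &, forall x y, x - y \in t} -> {in t &, forall x y, x * y \in t} ->
    {in t, forall x, e * x = x /\ x * e = x} ->
    {in t &, forall x y, x * y = 0 -> x = 0 \/ y = 0} ->
  {in t &, commutative *%R}.
Proof.
move=> te e0 tB tM te1 tdom.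
have t0 : 0 \in t by rewrite -(subrr e) tB.
have tN x : x \in t -> - x \in t by move=> tx; rewrite -sub0r tB.
have tD x y : x \in t -> y \in t -> x + y \in t.
  by move=> tx ty; rewrite -[y]opprK tB ?tN.
pose T := seq_sub t.
pose zeroT : T := SeqSub t0.
pose oneT : T := SeqSub te.
pose addT (x y : T) : T := SeqSub (tD _ _ (valP x) (valP y)).
pose oppT (x : T) : T := SeqSub (tN _ (valP x)).
pose mulT (x y : T) : T := SeqSub (tM _ _ (valP x) (valP y)).
have addA : associative addT by move=> x y z; apply/val_inj/addrA.
have addC : commutative addT by move=> x y; apply/val_inj/addrC.
have add0 : left_id zeroT addT by move=> x; apply/val_inj/add0r.
have addN : left_inverse zeroT oppT addT by move=> x; apply/val_inj/addNr.
have mulA : associative mulT by move=> x y z; apply/val_inj/mulrA.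
have mul1 : left_id oneT mulT.
  by move=> x; apply/val_inj; case: (te1 _ (valP x)).
have mulr1 : right_id oneT mulT.
  by move=> x; apply/val_inj; case: (te1 _ (valP x)).
have mulDl : left_distributive mulT addT.
  by move=> x y z; apply/val_inj/mulrDl.
have mulDr : right_distributive mulT addT.
  by move=> x y z; apply/val_inj/mulrDr.
have one0 : oneT != zeroT by rewrite -(inj_eq val_inj).
pose zT := GRing.isZmodule.Build T addA addC add0 addN.
pose Z : zmodType := HB.pack T zT.
pose rT := GRing.Zmodule_isNzRing.Build Z mulA mul1 mulr1 mulDl mulDr one0.
pose R : finNzRingType := HB.pack T zT rT.
pose uT := FinRing.isNzRing.Build R.
pose U : finUnitRingType := HB.pack T zT rT uT.
have domU : GRing.integral_domain_axiom U.
  move=> x y /(congr1 val) /= /(tdom _ _ (valP x) (valP y)).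
  by case=> xy0; [apply/orP; left | apply/orP; right]; apply/eqP/val_inj.
move=> x y tx ty.
by have /(congr1 val) := finDomain_mulrC domU (SeqSub tx : U) (SeqSub ty : U).
Qed.

(** Brauer's argument: a minimal right ideal that does not square to zero contains an idempotent e,
    and minimality makes the corner e s e free of zero divisors, hence commutative. *)
Lemma finite_semiprime_corner (M : nzRingType) (s : seq M) :
    1 \in s ->
    {in s &, forall x y, x - y \in s} -> {in s &, forall x y, x * y \in s} ->
    {in s, forall x, x != 0 -> exists2 r, r \in s & x * r * x != 0} ->
  exists e, [/\ e \in s, e != 0, e * e = e
    & {in s &, forall x y, (e * x * e) * (e * y * e) = (e * y * e) * (e * x * e)}].
Proof.
move=> s1 sB sM sP.
pose I x := undup [seq x * r | r <- s].
have inI x u : reflect (exists2 r, r \in s & u = x * r) (u \in I x).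
  by rewrite mem_undup; apply: mapP.
have II x r u : r \in s -> u \in I x -> u * r \in I x.
  move=> sr /inI[q sq ->]; apply/inI; exists (q * r); first exact: sM.
  by rewrite mulrA.
(* [I x] is the right ideal x s without repetitions, so the least k with [P k] yields a minimal
   right ideal. *)
pose P k := has (fun x => (x != 0) && (size (I x) == k)) s.
have exP : exists k, P k.
  by exists (size (I 1)); apply/hasP; exists 1; rewrite // oner_eq0 eqxx.
have [k /hasP[x sx /andP[x0 /eqP sizeIx]] minP] := ex_minnP exP.
have minI u : u \in I x -> u != 0 -> I u =i I x.
  move=> /inI[r sr Du] u0.
  have subI : {subset I u <= I x}.
    move=> v /inI[q sq ->]; rewrite Du -mulrA; apply/inI.
    by exists (r * q) => //; exact: sM.
  apply: (uniq_min_size (undup_uniq _) subI _).2.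
  rewrite sizeIx; apply: minP; apply/hasP; exists u; last by rewrite u0 eqxx.
  by rewrite Du sM.
have [r sr xrx0] := sP x sx x0.
pose y := x * r.
have Iy : y \in I x by apply/inI; exists r.
have y0 : y != 0 by apply: contraNneq xrx0; rewrite -/y => ->; rewrite mul0r.
have sI u : u \in I x -> u \in s by case/inI=> q sq ->; apply: sM.
have Iyx : y * x \in I x by rewrite II.
(* By minimality y lies in the right ideal of y x, so y = y x q for some q, and e = x q. Injectivity
   of left multiplication by y on [I x] then forces e e = e. *)
have [e Ie ye] : exists2 e, e \in I x & y = y * e.
  have /inI[q sq Dy] : y \in I (y * x) by rewrite minI.
  by exists (x * q); [apply/inI; exists q | rewrite mulrA].
have y_inj z : z \in I x -> y * z = 0 -> z = 0.
  move=> Iz yz0; apply/eqP/wlog_neg => nz.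
  have /inI[q sq De] : e \in I z by rewrite minI.
  by case/eqP: y0; rewrite ye De mulrA yz0 mul0r.
have se := sI e Ie.
have e0 : e != 0 by apply: contraNneq y0 => e0; rewrite ye e0 mulr0.
have IB u v : u \in I x -> v \in I x -> u - v \in I x.
  case/inI=> q sq -> /inI[q' sq' ->]; apply/inI; exists (q - q'); first exact: sB.
  by rewrite mulrBr.
have ee : e * e = e.
  apply/eqP; rewrite -subr_eq0; apply/eqP/y_inj; first by rewrite IB ?II.
  by rewrite mulrBr mulrA -!ye subrr.
exists e; split=> //.
pose t := [seq e * u * e | u <- s].
have tP u : u \in t -> [/\ u \in s, u \in I x, e * u = u & u * e = u].
  case/mapP=> q sq ->; split; first by rewrite !sM.
  - by rewrite II // II.
  - by rewrite !mulrA ee.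
  by rewrite -!mulrA ee.
have comm_t : {in t &, commutative *%R}.
  apply: (@finite_division_comm _ _ e) => //.
  - by apply/mapP; exists e => //; rewrite !ee.
  - move=> _ _ /mapP[u su ->] /mapP[v sv ->]; apply/mapP.
    by exists (u - v); rewrite ?sB // mulrBr mulrBl.
  - move=> u v /[dup] tu /tP[su _ eu _] /tP[sv _ _ ve].
    apply/mapP; exists (u * v); first exact: sM.
    by rewrite mulrA eu -mulrA ve.
  - by move=> u /tP[].
  move=> u v /tP[su Iu eu ue] /tP[sv Iv ev ve] uv0.
  have [->|v0] := eqVneq v 0; [by right | left].
  have /inI[q sq De] : e \in I v by rewrite minI.
  by rewrite -ue De mulrA uv0 mul0r.
by move=> u v su sv; apply: comm_t; apply/mapP; [exists u | exists v].
Qed.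

(** * Commutativity of Delta in positive characteristic *)

Section PositiveCharacteristic.

Variables (F : fieldType) (gT : finGroupType) (H : {group gT}) (n : nat).
Variable rV : mx_representation F H n.+1.
Hypothesis irrV : mx_irreducible rV.
Variable q : nat.
Hypothesis qF : q \in [pchar F].

(** Coefficients range over ['I_q], which makes the span over the prime field the codomain of a map
    from a finite type, hence a sequence. *)
Definition prime_span_term (c : {ffun gT -> 'I_q}) : 'M[F]_n.+1 :=
  \sum_(h in H) (c h)%:R *: rV h.
Definition prime_span := codom prime_span_term.

Lemma prime_spanP x :
  reflect (exists c : gT -> nat, x = \sum_(h in H) (c h)%:R *: rV h)
          (x \in prime_span).
Proof.
have q_gt0 := prime_gt0 (pcharf_prime qF).
apply: (iffP codomP) => [[c ->]|[c ->]]; first by exists (fun h => nat_of_ord (c h)).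
exists [ffun h => Ordinal (ltn_pmod (c h) q_gt0)].
apply: eq_bigr => h _; rewrite ffunE /= [in LHS](divn_eq (c h) q).
by rewrite natrD natrM (pcharf0 qF) mulr0 add0r.
Qed.

Lemma prime_spanD : {in prime_span &, forall x y, x + y \in prime_span}.
Proof.
move=> _ _ /prime_spanP[c ->] /prime_spanP[d ->]; apply/prime_spanP.
exists (fun h => c h + d h)%N; rewrite -big_split; apply: eq_bigr => h _ /=.
by rewrite natrD scalerDl.
Qed.

Lemma prime_spanB : {in prime_span &, forall x y, x - y \in prime_span}.
Proof.
move=> x _ sx /prime_spanP[d ->]; apply: prime_spanD => //; apply/prime_spanP.
exists (fun h => q.-1 * d h)%N; rewrite -sumrN; apply: eq_bigr => h _ /=.
rewrite -scaleNr natrM; congr (_ *: _).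
have -> : q.-1%:R = -1 :> F; last by rewrite mulN1r.
have q_gt0 := prime_gt0 (pcharf_prime qF).
by apply/eqP; rewrite -addr_eq0 natr1 prednK // (pcharf0 qF).
Qed.

Lemma prime_span_repr h : h \in H -> rV h \in prime_span.
Proof.
move=> Hh; apply/prime_spanP; exists (fun k => (k == h) : nat).
rewrite (bigD1 h) //= eqxx scale1r big1 ?addr0 // => k /andP[_ /negPf->].
by rewrite scale0r.
Qed.

Lemma prime_span1 : 1 \in prime_span.
Proof. by rewrite -[1](repr_mx1 rV) prime_span_repr. Qed.

Lemma prime_spanM : {in prime_span &, forall x y, x * y \in prime_span}.
Proof.
have s0 : 0 \in prime_span by rewrite -(subrr 1) prime_spanB ?prime_span1.
have sMn x k : x \in prime_span -> k%:R *: x \in prime_span.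
  move=> sx; elim: k => [|k IHk]; first by rewrite scale0r.
  by rewrite -natr1 scalerDl scale1r prime_spanD.
move=> _ _ /prime_spanP[c ->] /prime_spanP[d ->].
rewrite mulr_suml; apply: (big_ind (fun x => x \in prime_span)) => // [|h Hh].
  exact: prime_spanD.
rewrite mulr_sumr; apply: (big_ind (fun x => x \in prime_span)) => // [|k Hk].
  exact: prime_spanD.
rewrite -scalerAl -scalerAr scalerA -natrM; apply: sMn.
by rewrite -mulmxE -repr_mxM // prime_span_repr ?groupM.
Qed.

(** If x r x = 0 for every r in the span, then x kills the FH-submodule generated by its own row
    space. For x nonzero that submodule is all of V, which forces x = 0. *)
Lemma prime_span_semiprime :
  {in prime_span, forall x, x != 0 ->
     exists2 r, r \in prime_span & x * r * x != 0}.
Proof.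
move=> x sx x0.
have [|no_h] := boolP [exists h in H, x * rV h * x != 0].
  by case/exists_inP=> h Hh nz; exists (rV h); rewrite ?prime_span_repr.
have xhx h : h \in H -> x * rV h * x = 0.
  by move=> Hh; apply/eqP; apply: contraNT no_h => nz; apply/exists_inP; exists h.
pose U := (\sum_(h in H) <<x *m rV h>>)%MS.
have modU : mxmodule rV U.
  apply/mxmoduleP=> k Hk; rewrite sumsmxMr; apply/sumsmx_subP=> h Hh.
  rewrite (eqmxMr _ (genmxE _)) -mulmxA -repr_mxM //.
  by rewrite (sumsmx_sup (h * k)%g) ?groupM // genmxE.
have Ux : (x <= U)%MS.
  by rewrite (sumsmx_sup 1%g) // genmxE repr_mx1 mulmx1.
have /mx_irrP[_ fullU] := irrV.
have nzU : U != 0 by apply: contraNneq x0 => U0; rewrite -submx0 -U0.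
have /row_fullP[B BU] := fullU U modU nzU.
have Ux0 : U *m x = 0.
  apply/eqP; rewrite -submx0 sumsmxMr; apply/sumsmx_subP=> h Hh.
  by rewrite (eqmxMr _ (genmxE _)) [_ *m _ *m _]xhx // submx0.
by case/eqP: x0; rewrite -[x]mul1mx -BU -mulmxA Ux0 mulmx0.
Qed.

(** Take the idempotent e of a commutative corner and a nonzero v with v e = v. Irreducibility gives
    v f = v X for some X in the F-span of the corner, and likewise for g. Those X commute with one
    another and with f and g, so v (f g - g f) = 0, and Schur's lemma concludes. *)
Lemma pchar_centgmx_comm f g : centgmx rV f -> centgmx rV g -> f * g = g * f.
Proof.
move=> cf cg.
have [e [se e0 ee ecomm]] := finite_semiprime_corner prime_span1 prime_spanB
  prime_spanM prime_span_semiprime.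
have cent_e f' : centgmx rV f' -> e * f' = f' * e.
  move=> cf'; case/prime_spanP: se => c ->; rewrite mulr_suml mulr_sumr.
  apply: eq_bigr => h Hh; rewrite -scalerAl -scalerAr; congr (_ *: _).
  exact/esym/(centgmxP cf').
have [v /submxP[w Dv] v0] := rowV0Pn e0.
have ve : v *m e = v by rewrite Dv -mulmxA [e *m e]ee.
pose X (c : gT -> F) := \sum_(h in H) c h *: (e * rV h * e).
have cyc_v f' : centgmx rV f' -> exists c, v *m f' = v *m X c.
  move=> cf'.
  have: (v *m f' <= cyclic_mx rV v)%MS.
    by rewrite -(mxsimple_cyclic irrV v0 (submx1 v)) submx1.
  case/cyclic_mxP=> A /envelop_mxP[c ->] Dvf; exists c.
  have -> : X c = e * (\sum_(h in H) c h *: rV h) * e.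
    rewrite mulr_sumr mulr_suml; apply: eq_bigr => h _.
    by rewrite -scalerAr -scalerAl.
  by rewrite -!mulmxE !mulmxA ve -Dvf -{1}ve -!mulmxA [e *m _]cent_e.
have commX c d : X c * X d = X d * X c.
  rewrite /X mulr_suml [RHS]mulr_sumr; apply: eq_bigr => h Hh.
  rewrite mulr_sumr mulr_suml; apply: eq_bigr => k Hk.
  by rewrite -!scalerAl -!scalerAr ecomm ?prime_span_repr // !scalerA mulrC.
have centX c f' : centgmx rV f' -> X c * f' = f' * X c.
  move=> cf'; rewrite mulr_suml mulr_sumr; apply: eq_bigr => h Hh.
  rewrite -scalerAl -scalerAr; congr (_ *: _).
  have rf' : rV h * f' = f' * rV h by apply/esym/(centgmxP cf').
  have ef' := cent_e f' cf'.
  by rewrite -(mulrA (e * rV h)) ef' mulrA -(mulrA e) rf' !mulrA ef'.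
have vfg : v *m (f * g - g * f) = 0.
  have [c vf] := cyc_v f cf; have [d vg] := cyc_v g cg.
  rewrite mulmxBr -!mulmxE !mulmxA vf vg -!mulmxA !mulmxE !centX //.
  by rewrite -!mulmxE !mulmxA vf vg -!mulmxA !mulmxE commX subrr.
apply/eqP; rewrite -subr_eq0; apply/wlog_neg => nz.
have cfg : centgmx rV (f * g - g * f).
  apply/centgmxP => h Hh; rewrite -!mulmxE mulmxBr mulmxBl !mulmxA.
  rewrite -!(centgmxP cf h Hh) -!(centgmxP cg h Hh) -!mulmxA.
  by rewrite -!(centgmxP cf h Hh) -!(centgmxP cg h Hh).
by case/eqP: v0; rewrite -[v](mulmxK (mx_Schur irrV cfg nz)) vfg mul0mx.
Qed.

End PositiveCharacteristic.

(** * Delta and its centre as division-closed subsets of the matrix ring *)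

Section EndomorphismAlgebraTheory.

Variables (F : fieldType) (gT : finGroupType) (H : {group gT}) (n : nat).
Variable rV : mx_representation F H n.+1.
Local Notation Delta := (endalg rV).
Local Notation Z := (endcenter rV).

Lemma endalgP f :
  reflect (forall h, h \in H -> f * rV h = rV h * f) (f \in Delta).
Proof. by rewrite inE memmx_cent_envelop; apply: centgmxP. Qed.

Lemma endcenterP f :
  reflect (f \in Delta /\ {in Delta, forall g, f * g = g * f}) (f \in Z).
Proof.
rewrite inE; apply: (iffP center_mxP) => -[Df cf]; split=> //.
  by move=> g Dg; rewrite -mulmxE cf.
by move=> g Dg; rewrite [RHS]cf.
Qed.

Lemma endalg_divring : divring_closed Delta.
Proof.
split=> [|f g /endalgP cf /endalgP cg|f g /endalgP cf /endalgP cg].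
- by apply/endalgP=> h _; rewrite mul1r mulr1.
- by apply/endalgP=> h Hh; rewrite mulrBl mulrBr cf ?cg.
apply/endalgP=> h Hh; rewrite -mulrA.
have /commrV <- : GRing.comm (rV h) g by rewrite /GRing.comm cg.
by rewrite !mulrA cf.
Qed.
HB.instance Definition _ :=
  GRing.isDivringClosed.Build 'M[F]_n.+1 Delta endalg_divring.

Lemma endcenter_divring : divring_closed Z.
Proof.
split=> [|f g /endcenterP[Df cf] /endcenterP[Dg cg]|].
- by apply/endcenterP; split=> [|g _]; rewrite ?rpred1 // mul1r mulr1.
- apply/endcenterP; split=> [|h Dh]; first exact: rpredB.
  by rewrite mulrBl mulrBr cf ?cg.
move=> f g /endcenterP[Df cf] /endcenterP[Dg cg].
apply/endcenterP; split=> [|h Dh]; first exact: rpred_div.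
rewrite -mulrA; have /commrV <- : GRing.comm h g by rewrite /GRing.comm cg.
by rewrite !mulrA cf.
Qed.
HB.instance Definition _ :=
  GRing.isDivringClosed.Build 'M[F]_n.+1 Z endcenter_divring.

Lemma endcenter_sub : {subset Z <= Delta}.
Proof. by move=> f /endcenterP[]. Qed.

Hypothesis irrV : mx_irreducible rV.

Lemma endalg_unit f : f \in Delta -> f != 0 -> f \is a GRing.unit.
Proof. by rewrite inE memmx_cent_envelop; apply: mx_Schur. Qed.

Lemma endalg_mulf_eq0 f g : f \in Delta -> f * g = 0 -> f = 0 \/ g = 0.
Proof.
move=> Df fg0; have [->|nz_f] := eqVneq f 0; [by left | right].
by rewrite -[g](mulKr (endalg_unit Df nz_f)) fg0 mulr0.
Qed.

End EndomorphismAlgebraTheory.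

Lemma natr_mx_unit (F : fieldType) n k :
  (k%:R : F) != 0 -> (k%:R : 'M[F]_n.+1) \is a GRing.unit.
Proof. by move=> nz; rewrite -scaler_nat scaler_unit ?unitfE ?unitr1. Qed.

(** * Representations afforded by a basis of a submodule *)

Section Affords.

Variables (F : fieldType) (gT : finGroupType) (G : {group gT}) (N n : nat).
Variable rG : mx_representation F G N.

Lemma affords_exists (B : 'M[F]_(n, N)) :
  row_free B -> mxmodule rG B -> exists rB, @affords F gT G N n rG B rB.
Proof.
move=> freeB /mxmoduleP modB.
pose r g := B *m rG g *m pinvmx B.
have rE g : g \in G -> B *m rG g = r g *m B.
  by move=> Gg; rewrite mulmxKpV ?modB.
have r_repr : mx_repr G r.
  split=> [|x y Gx Gy]; apply: (row_free_inj freeB).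
    by rewrite -rE // repr_mx1 mulmx1 mul1mx.
  by rewrite -rE ?groupM // -mulmxA -rE // mulmxA -rE // repr_mxM // mulmxA.
by exists (MxRepresentation r_repr).
Qed.

Lemma affords_rsim_submod (B : 'M[F]_(n, N)) (rB : mx_representation F G n)
    (U : 'M[F]_N) (modU : mxmodule rG U) :
  affords rG B rB -> (U :=: B)%MS -> mx_rsim rB (submod_repr modU).
Proof.
case=> freeB BrB defU; have sBU : (B <= U)%MS by rewrite defU.
exists (in_submod U B).
- by rewrite defU; apply/esym/eqP.
- by rewrite /row_free mxrank_in_submod.
by move=> g Gg; rewrite -[RHS]in_submodJ // BrB // [RHS]/in_submod /= !mulmxA.
Qed.

End Affords.

(** * Eigenvectors X a = gamma theta X as extensions of V to G *)

Section Extension.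

Variables (F : fieldType) (gT : finGroupType) (G H : {group gT}).
Hypothesis sHG : H \subset G.
Variables (a : gT) (n N : nat).
Hypothesis aG : a \in G.
(* G is generated by H and a. *)
Hypothesis G_ind : forall Q : gT -> Prop,
    (forall h, h \in H -> Q h) -> Q a ->
    (forall x y, x \in G -> y \in G -> Q x -> Q y -> Q (x * y)%g) ->
  forall g, g \in G -> Q g.
Variables (rV : mx_representation F H n.+1) (rG : mx_representation F G N).
Hypothesis irrV : mx_irreducible rV.
(* gamma stands for alpha eps^-1. *)
Variable gamma : 'M[F]_n.+1.
Hypothesis gammaU : gamma \is a GRing.unit.
Hypothesis gammaC : forall f, f \in endalg rV -> f * gamma = gamma * f.
Local Notation Delta := (endalg rV).
Local Notation rH := (subg_repr rG sHG).
Implicit Types (X Y : 'M[F]_(n.+1, N)).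

Definition Hhom X := forall h, h \in H -> rV h *m X = X *m rG h.

Lemma HhomD X Y : Hhom X -> Hhom Y -> Hhom (X + Y).
Proof. by move=> hX hY h Hh; rewrite mulmxDl mulmxDr hX ?hY. Qed.

Lemma Hhom0 : Hhom 0.
Proof. by move=> h Hh; rewrite mulmx0 mul0mx. Qed.

Lemma HhomM f X : f \in Delta -> Hhom X -> Hhom (f *m X).
Proof.
by move=> /endalgP cf hX h Hh; rewrite -mulmxA -hX // !mulmxA [f *m _](cf h Hh).
Qed.

Lemma Hhom_sum (I : Type) (r : seq I) (P : pred I) (f : I -> 'M[F]_(n.+1, N)) :
  (forall i, P i -> Hhom (f i)) -> Hhom (\sum_(i <- r | P i) f i).
Proof.
by move=> hf; apply: (big_ind Hhom) => //; [apply: Hhom0 | apply: HhomD].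
Qed.

(** The kernel of an FH-homomorphism is a submodule of the irreducible V. *)
Lemma Hhom_free X : Hhom X -> X != 0 -> row_free X.
Proof.
move=> hX nzX; rewrite -kermx_eq0; apply: wlog_neg => nzK.
have modK : mxmodule rV (kermx X).
  apply/mxmoduleP=> h Hh; apply/sub_kermxP.
  by rewrite -mulmxA hX // mulmxA mulmx_ker mul0mx.
have /mx_irrP[_ /(_ _ modK nzK)/row_fullP[B BK]] := irrV.
by case/eqP: nzX; rewrite -[X]mul1mx -BK -mulmxA mulmx_ker mulmx0.
Qed.

Lemma Hhom_simple X : Hhom X -> X != 0 -> mxsimple rH <<X>>%MS.
Proof.
move=> hX nzX; have freeX := Hhom_free hX nzX.
split=> [||U /mxmoduleP modU]; last 1 first.
- rewrite !genmxE => sUX nzU; have DU := mulmxKpV sUX.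
  pose K := U *m pinvmx X.
  have modK : mxmodule rV <<K>>%MS.
    apply/mxmoduleP=> h Hh; rewrite (eqmxMr _ (genmxE _)) genmxE.
    rewrite -(submxMfree _ _ freeX) DU -mulmxA hX // mulmxA DU.
    exact: modU.
  have nzK : <<K>>%MS != 0.
    rewrite -mxrank_eq0 genmxE mxrank_eq0; apply: contraNneq nzU => K0.
    by rewrite -DU -/K K0 mul0mx.
  have /mx_irrP[_ /(_ _ modK nzK)] := irrV.
  rewrite -sub1mx genmxE => sK.
  by rewrite -DU -[X in (X <= _)%MS]mul1mx submxMr.
- apply/mxmoduleP=> h Hh; rewrite (eqmxMr _ (genmxE _)) genmxE.
  by rewrite -hX // submxMl.
by rewrite -mxrank_eq0 genmxE mxrank_eq0.
Qed.

Lemma Hhom_module X : Hhom X -> (X *m rG a <= X)%MS -> mxmodule rG X.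
Proof.
move=> hX aX; apply/mxmoduleP; apply: G_ind => // [h Hh|x y Gx Gy xX yX].
  by rewrite -hX // submxMl.
by rewrite repr_mxM // mulmxA (submx_trans (submxMr _ xX)).
Qed.

Lemma Hhom_simpleG X :
  Hhom X -> X != 0 -> (X *m rG a <= X)%MS -> mxsimple rG <<X>>%MS.
Proof.
move=> hX nzX aX; apply: mxsimple_subg (Hhom_simple hX nzX).
by rewrite (eqmx_module _ (genmxE X)) Hhom_module.
Qed.

Section Representation.

Variables (rB : mx_representation F G n.+1) (theta : 'M[F]_n.+1).
Hypothesis rBa : rB a = gamma * theta.
Hypothesis rBH : forall h, h \in H -> rB h = rV h.

Lemma Hhom_affords X : Hhom X -> X != 0 ->
  X *m rG a = gamma *m theta *m X -> affords rG X rB.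
Proof.
move=> hX nzX XA; split; first exact: Hhom_free.
apply: G_ind => [h Hh||x y Gx Gy xX yX]; first by rewrite -hX // rBH.
  by rewrite XA rBa.
by rewrite !repr_mxM // mulmxA xX -(mulmxA _ X) yX mulmxA.
Qed.

(** Commuting with gamma theta amounts to commuting with theta, because gamma is invertible and
    commutes with Delta. *)
Lemma extension_endalg f :
  f \in endalg rB <-> f \in Delta /\ f * theta = theta * f.
Proof.
split=> [/endalgP cf|[Df cf]]; last first.
  apply/endalgP; apply: G_ind => [h Hh||x y Gx Gy fx fy].
  - by rewrite rBH //; move/endalgP: Df; apply.
  - by rewrite rBa mulrA gammaC // -mulrA cf mulrA.
  by rewrite !repr_mxM // mulmxE mulrA fx -mulrA fy mulrA.
have Df : f \in Delta.
  by apply/endalgP=> h Hh; rewrite -rBH // cf // (subsetP sHG).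
split=> //; apply: (mulrI gammaU).
by rewrite mulrA -gammaC // -mulrA -rBa cf // rBa mulrA.
Qed.

End Representation.

Lemma extension_exists theta X : Hhom X -> X != 0 ->
    X *m rG a = gamma *m theta *m X ->
  exists rB : mx_representation F G n.+1,
    [/\ affords rG X rB, rB a = gamma * theta
      & forall h, h \in H -> rB h = rV h].
Proof.
move=> hX nzX XA; have freeX := Hhom_free hX nzX.
have modX : mxmodule rG X by apply: Hhom_module; rewrite // XA submxMl.
have [rB BrB] := affords_exists freeX modX.
exists rB; split=> // [|h Hh]; apply: (row_free_inj freeX).
  by rewrite -BrB.2 // XA.
by rewrite -BrB.2 ?(subsetP sHG) // hX.
Qed.

Section Isomorphism.

Variables (X Y : 'M[F]_(n.+1, N)) (theta theta' : 'M[F]_n.+1).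
Hypotheses (hX : Hhom X) (hY : Hhom Y) (nzX : X != 0) (nzY : Y != 0).
Hypotheses (XA : X *m rG a = gamma *m theta *m X).
Hypotheses (YA : Y *m rG a = gamma *m theta' *m Y).

Let freeX := Hhom_free hX nzX.
Let freeY := Hhom_free hY nzY.

(** An isomorphism f carries the rows of X into the row space of Y, so X f = d Y for some matrix d.
    As Y is free, compatibility with H puts d in Delta, and compatibility with [a] gives theta d = d
    theta'. *)
Lemma mx_iso_intertwines : mx_iso rG <<X>>%MS <<Y>>%MS ->
  exists d, [/\ d \in Delta, d \is a GRing.unit & theta * d = d * theta'].
Proof.
case=> f f_unit; rewrite genmxE => /hom_mxP homf /eqmxP/andP[sfY _].
have [d DXf] : exists d, X *m f = d *m Y.
  by apply/submxP; move: sfY; rewrite genmxE (eqmxMr _ (genmxE X)).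
have Dd : d \in Delta.
  apply/endalgP=> h Hh; apply: (row_free_inj freeY).
  rewrite -!mulmxE -mulmxA hY // mulmxA -DXf.
  by rewrite -[RHS]mulmxA -DXf -homf ?(subsetP sHG) // -hX // mulmxA.
exists d; split=> //.
  apply: (endalg_unit irrV Dd); apply: contraNneq nzX => d0.
  by rewrite -(mulmxK f_unit X) DXf d0 !mul0mx.
apply: (mulrI gammaU); apply: (row_free_inj freeY).
transitivity (X *m rG a *m f).
  by rewrite XA -[_ *m X *m f]mulmxA DXf !mulmxA !mulmxE mulrA.
rewrite homf // DXf -mulmxA YA [gamma * _]mulrA -gammaC //.
by rewrite !mulmxA !mulmxE.
Qed.

Lemma intertwines_mx_iso d : d \in Delta -> d \is a GRing.unit ->
  theta * d = d * theta' -> mx_iso rG <<X>>%MS <<Y>>%MS.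
Proof.
move=> Dd dU d_theta.
have [f DXf] : exists f, X *m f = d *m Y.
  by exists (pinvmx X *m (d *m Y)); rewrite mulmxA mulmxVp ?mul1mx.
have sXA : (X *m rG a <= X)%MS by rewrite XA submxMl.
have sYA : (Y *m rG a <= Y)%MS by rewrite YA submxMl.
have /mxmoduleP modX := Hhom_module hX sXA.
apply: (@mx_Schur_iso _ _ _ _ _ _ _ f); try exact: Hhom_simpleG.
- rewrite genmxE; apply/hom_mxP; apply: G_ind => [h Hh||x y Gx Gy homx homy].
  + rewrite -hX // -mulmxA DXf -mulmxA -hY // !mulmxA; congr (_ *m _).
    by move/endalgP: Dd => /(_ h Hh).
  + rewrite XA DXf -!mulmxA YA DXf !mulmxA !mulmxE; congr (_ *m _).
    by rewrite -mulrA d_theta mulrA -gammaC // -mulrA.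
  rewrite repr_mxM // (mulmxA X) [RHS]mulmxA -homx.
  have /submxP[k ->] := modX x Gx.
  by rewrite -!(mulmxA k) homy.
- by rewrite (eqmxMr _ (genmxE X)) DXf genmxE submxMl.
rewrite -mxrank_eq0 (eqmxMr _ (genmxE X)) DXf mxrank_eq0.
by apply: contraNneq nzY => dY0; rewrite -[Y](mulKmx dU) dY0 mulmx0.
Qed.

End Isomorphism.

End Extension.

Section ExtensionSection.

Variables (F : fieldType) (gT : finGroupType) (G H : {group gT}).
Hypothesis sHG : H \subset G.
Variables (a : gT) (n N : nat).
Hypothesis aG : a \in G.
Hypothesis G_ind : forall Q : gT -> Prop,
    (forall h, h \in H -> Q h) -> Q a ->
    (forall x y, x \in G -> y \in G -> Q x -> Q y -> Q (x * y)%g) ->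
  forall g, g \in G -> Q g.
Variables (rV : mx_representation F H n.+1) (rG : mx_representation F G N).
Hypothesis irrV : mx_irreducible rV.
Variables gamma theta : 'M[F]_n.+1.
Variable rB : mx_representation F G n.+1.
Hypothesis rBa : rB a = gamma * theta.
Hypothesis rBH : forall h, h \in H -> rB h = rV h.

(** Modulo W' the homomorphism Y becomes a genuine eigenvector, so [Hhom_affords] applies with the
    factor module in the role of [rG]. *)
Lemma extension_rsim_section (Y : 'M[F]_(n.+1, N)) (W' W : 'M[F]_N)
    (modW' : mxmodule rG W') (modW : mxmodule rG W) :
    Hhom rV rG Y -> (W :=: W' + Y)%MS -> ~~ (Y <= W')%MS ->
    (Y *m rG a - gamma *m theta *m Y <= W')%MS ->
  mx_rsim rB (section_repr modW' modW).
Proof.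
move=> hY defW notYW YA; pose X := in_factmod W' Y.
have in_fM (A : 'M[F]_n.+1) B : in_factmod W' (A *m B) = A *m in_factmod W' B.
  by rewrite /in_factmod /= mulmxA.
have hX : Hhom rV (factmod_repr modW') X.
  move=> h Hh; rewrite -[RHS]in_factmodJ ?(subsetP sHG) //.
  by rewrite -hY // in_fM.
have nzX : X != 0 by rewrite in_factmod_eq0.
have XA : X *m factmod_repr modW' a = gamma *m theta *m X.
  rewrite -[LHS]in_factmodJ // -in_fM; apply/eqP; rewrite -subr_eq0 -linearB /=.
  by rewrite in_factmod_eq0.
apply: affords_rsim_submod (Hhom_affords G_ind irrV rBa rBH hX nzX XA) _.
apply: eqmx_trans (genmxE _) _; apply: eqmx_trans (in_factmod_addsK W' Y).
exact: eqmxMr defW.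
Qed.

End ExtensionSection.

(** * FH-homomorphisms as row vectors over Delta *)

Section Basis.
Variables (F : fieldType) (gT : finGroupType) (G H : {group gT}).
Hypothesis sHG : H \subset G.
Variables (a : gT) (n N : nat).
Hypothesis aG : a \in G.
Hypothesis G_ind : forall Q : gT -> Prop,
    (forall h, h \in H -> Q h) -> Q a ->
    (forall x y, x \in G -> y \in G -> Q x -> Q y -> Q (x * y)%g) ->
  forall g, g \in G -> Q g.
Variables (rV : mx_representation F H n.+1) (rG : mx_representation F G N).
Hypothesis irrV : mx_irreducible rV.
Variable gamma : 'M[F]_n.+1.
Hypothesis gammaU : gamma \is a GRing.unit.
Hypothesis gammaC : forall f, f \in endalg rV -> f * gamma = gamma * f.
Local Notation Delta := (endalg rV).
Local Notation Z := (endcenter rV).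
Local Notation Hhom := (Hhom rV rG).
Local Notation rH := (subg_repr rG sHG).
Variables (p : nat) (p_pr : prime p).
(* b i stands for eps^i alpha^-i a^i; the c i are the dual coordinates. *)
Variables (b : nat -> 'M[F]_(n.+1, N)) (c : nat -> 'M[F]_(N, n.+1)).
Hypothesis bH : forall i, Hhom (b i).
Hypothesis bS : forall i, b i *m rG a = gamma *m b i.+1.
Hypothesis bc : forall i j : 'I_p, b i *m c j = (i == j)%:R%:M.
Hypothesis cb : \sum_(i < p) c i *m b i = 1%:M.
Implicit Types (X Y : 'M[F]_(n.+1, N)).

Lemma basis_coord m (x : nat -> 'M[F]_(m, n.+1)) (j : 'I_p) :
  (\sum_(i < p) x i *m b i) *m c j = x j.
Proof.
rewrite mulmx_suml (bigD1 j) //= -mulmxA bc eqxx mulmx1 big1 ?addr0 // => i.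
by move=> /negPf nij; rewrite -mulmxA bc nij raddf0 mulmx0.
Qed.

Lemma basis_expand m (X : 'M[F]_(m, N)) :
  X = \sum_(i < p) (X *m c i) *m b i.
Proof.
rewrite -[LHS]mulmx1 -cb mulmx_sumr; apply: eq_bigr => i _.
by rewrite mulmxA.
Qed.

Lemma coordH (j : 'I_p) h : h \in H -> rG h *m c j = c j *m rV h.
Proof.
move=> Hh; rewrite -[LHS]mul1mx -cb mulmx_suml (bigD1 j) //= big1 => [|i nij].
  rewrite addr0 -mulmxA (mulmxA (b j)) -bH // -(mulmxA (rV h)) bc eqxx.
  by rewrite mulmx1.
rewrite -mulmxA (mulmxA (b i)) -bH // -(mulmxA (rV h)) bc (negPf nij).
by rewrite raddf0 !mulmx0.
Qed.

Lemma Hhom_coord X (j : 'I_p) : Hhom X -> X *m c j \in Delta.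
Proof.
move=> hX; apply/endalgP=> h Hh.
by rewrite -[LHS]mulmxA -coordH // [LHS]mulmxA -hX // -mulmxA.
Qed.

Lemma basis_neq0 (j : 'I_p) : b j != 0.
Proof.
apply: contra_eqN (bc j j) => /eqP->; rewrite mul0mx eqxx.
by rewrite eq_sym oner_eq0.
Qed.

(** The whole module is homogeneous over H, so S restricted to H is a sum of copies of V, each of
    which is the image of an FH-homomorphism. *)
Lemma Hhom_generates m (S : 'M[F]_N) (K : 'M[F]_(m, N)) : mxmodule rG S ->
  (forall X, Hhom X -> (X <= S)%MS -> (X <= K)%MS) -> (S <= K)%MS.
Proof.
move=> modS genS; pose o : 'I_p := Ordinal (prime_gt0 p_pr).
pose M := <<b o>>%MS; have simM : mxsimple rH M.
  exact: Hhom_simple (bH o) (basis_neq0 o).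
(* The matrix c_0 b_i maps the image of b_0 isomorphically onto that of b_i, and these images
   together span everything. *)
have comp1 : (1%:M <= component_mx rH M)%MS.
  rewrite -cb; apply: summx_sub => i _; rewrite (submx_trans (submxMl _ _)) //.
  rewrite -(genmxE (b i)); apply: mx_iso_component => //.
  have Dbi : b o *m (c o *m b i) = b i by rewrite mulmxA bc eqxx mul1mx.
  apply: (@mx_Schur_iso _ _ _ _ _ _ _ (c o *m b i)) => //.
  - exact: Hhom_simple (bH i) (basis_neq0 i).
  - rewrite genmxE; apply/hom_mxP=> h Hh.
    by rewrite -bH // -mulmxA Dbi bH.
  - by rewrite (eqmxMr _ (genmxE _)) Dbi genmxE.
  by rewrite -mxrank_eq0 (eqmxMr _ (genmxE _)) Dbi mxrank_eq0 basis_neq0.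
have sS1 : (S <= component_mx rH M)%MS by exact: submx_trans (submx1 _) comp1.
have [I W /= simW defS _] := mxsemisimpleS (mxmodule_subg sHG modS) sS1
  (component_mx_semisimple simM).
rewrite -defS; apply/sumsmx_subP=> i _.
have sWS : (W i <= S)%MS by rewrite -defS (sumsmx_sup i).
have [f _ homf] := component_mx_iso simM (simW i) (submx_trans sWS sS1).
move=> defW.
have /hom_mxP homb : (b o <= dom_hom_mx rH f)%MS by rewrite -(genmxE (b o)).
have bfW : (b o *m f :=: W i)%MS.
  by apply: eqmx_trans defW; rewrite -/M; apply/eqmxMr/eqmx_sym/genmxE.
rewrite -bfW; apply: genS; last by rewrite bfW.
by move=> h Hh; rewrite mulmxA bH // homb.
Qed.

End Basis.

(** * Characteristic p: one Jordan block and a uniserial module *)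

Section Modular.
Variables (F : fieldType) (gT : finGroupType) (G H : {group gT}).
Hypothesis sHG : H \subset G.
Variables (a : gT) (n N : nat).
Hypothesis aG : a \in G.
Hypothesis G_ind : forall Q : gT -> Prop,
    (forall h, h \in H -> Q h) -> Q a ->
    (forall x y, x \in G -> y \in G -> Q x -> Q y -> Q (x * y)%g) ->
  forall g, g \in G -> Q g.
Variables (rV : mx_representation F H n.+1) (rG : mx_representation F G N).
Hypothesis irrV : mx_irreducible rV.
Variable gamma : 'M[F]_n.+1.
Hypothesis gammaU : gamma \is a GRing.unit.
Hypothesis gammaC : forall f, f \in endalg rV -> f * gamma = gamma * f.
Local Notation Delta := (endalg rV).
Local Notation Z := (endcenter rV).
Local Notation Hhom := (Hhom rV rG).
Local Notation rH := (subg_repr rG sHG).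
Variables (p : nat) (p_pr : prime p).
Variables (b : nat -> 'M[F]_(n.+1, N)) (c : nat -> 'M[F]_(N, n.+1)).
Hypothesis bH : forall i, Hhom (b i).
Hypothesis bS : forall i, b i *m rG a = gamma *m b i.+1.
Hypothesis bc : forall i j : 'I_p, b i *m c j = (i == j)%:R%:M.
Hypothesis cb : \sum_(i < p) c i *m b i = 1%:M.
Implicit Types (X Y : 'M[F]_(n.+1, N)).
Variables (xi : 'M[F]_n.+1).
Hypotheses (xiZ : xi \in Z) (xiU : xi \is a GRing.unit).
Hypothesis bp : b p = xi ^+ p *m b 0.
Hypothesis pF : p \in [pchar F].

Let p_gt0 := prime_gt0 p_pr.
Let xiD : xi \in Delta := endcenter_sub xiZ.

(* [nabla] becomes multiplication by 1 - xi^-1 s when the FH-homomorphisms    *)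
(* V -> V^ are identified with Delta[s]/(s^p - eta), b_i being s^i.           *)
Definition nabla X := X - xi^-1 *m (gamma^-1 *m (X *m rG a)).

Lemma nablaD X Y : nabla (X + Y) = nabla X + nabla Y.
Proof. by rewrite /nabla mulmxDl !mulmxDr opprD addrACA. Qed.

Lemma nabla0 : nabla 0 = 0.
Proof. by rewrite /nabla mul0mx !mulmx0 subr0. Qed.

Lemma nabla_sum (I : Type) (r : seq I) (P : pred I) (f : I -> 'M[F]_(n.+1, N)) :
  nabla (\sum_(i <- r | P i) f i) = \sum_(i <- r | P i) nabla (f i).
Proof. exact: (big_morph nabla nablaD nabla0). Qed.

Lemma nablaM f X : f \in Delta -> nabla (f *m X) = f *m nabla X.
Proof.
move=> Df; rewrite /nabla mulmxBr; congr (_ - _); rewrite !mulmxA; congr (_ *m _ *m _).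
have fg : GRing.comm f gamma^-1 by apply/commrV/gammaC.
have fx : GRing.comm f xi^-1.
  by apply: commrV; apply/esym; case/endcenterP: xiZ => _; apply.
by rewrite !mulmxE -mulrA -fg mulrA -fx.
Qed.

Lemma nabla_module (S : 'M[F]_N) X :
  mxmodule rG S -> (X <= S)%MS -> (nabla X <= S)%MS.
Proof.
move=> modS sXS; rewrite addmx_sub // eqmx_opp.
by do 2!apply: mulmx_sub; apply: mxmodule_trans sXS.
Qed.

Lemma nabla_act X : X *m rG a = gamma *m xi *m (X - nabla X).
Proof.
rewrite /nabla opprB addrC subrK !mulmxA -(mulmxA gamma) !mulmxE.
by rewrite mulrV // mulr1 mulrV // mul1mx.
Qed.

(** Rescaled so that the relation b_p = xi^p b_0 becomes the periodicity [yp]. *)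
Let y j := xi ^- j *m b j.

Let nabla_y j : nabla (y j) = y j - y j.+1.
Proof.
rewrite nablaM ?rpredV ?rpredX // /nabla bS mulmxBr [gamma^-1 *m _]mulmxA.
rewrite mulmxE mulVr // mul1mx mulmxA mulmxE; congr (_ - _ *m _).
by rewrite -invrM ?unitrX // exprS.
Qed.

Let yp : y p = y 0.
Proof. by rewrite /y bp mulmxA mulmxE mulVr ?unitrX // mul1mx invr1 mul1mx. Qed.

(** In characteristic p, for 0 < i <= p, this corresponds to the polynomial (1 - xi^-1 s)^(p-i):
    modulo p its coefficients are those of (1 - t)^-i, since (1 - t)^p = 1 - t^p. *)
Definition wvec i :=
  \sum_(0 <= j < (p - i).+1) ('C(i + j - 1, j)%:R * xi ^- j) *m b j.

Let wE i : wvec i = \sum_(0 <= j < (p - i).+1) y j *+ 'C(i + j - 1, j).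
Proof.
by apply: eq_bigr => j _; rewrite mulr_natl /y -!scaler_nat scalemxAl.
Qed.

Let row_pchar X : X *+ p = 0.
Proof. by rewrite -scaler_nat (pcharf0 pF) scale0r. Qed.

Lemma wvecH i : Hhom (wvec i).
Proof.
apply: Hhom_sum => j _; apply: HhomM => //.
by rewrite rpredM ?rpred_nat // rpredV rpredX.
Qed.

Lemma nabla_wvec1 : nabla (wvec 1) = 0.
Proof.
rewrite wE nabla_sum; under eq_bigr => j _.
  rewrite add1n subn1 binn mulr1n nabla_y -opprB; over.
by rewrite sumrN telescope_sumr // subn1 prednK // yp subrr oppr0.
Qed.

(** Summation by parts and Pascal's rule leave a single boundary term, whose coefficient is a
    binomial 'C(p, j) with 0 < j < p and so vanishes. *)
Lemma nabla_wvecS i : (0 < i < p)%N -> nabla (wvec i.+1) = wvec i.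
Proof.
case/andP; case: i => // k _ lt_kp.
have abel m : \sum_(0 <= j < m.+1) nabla (y j *+ 'C(k.+1 + j, j))
    + y m.+1 *+ 'C(k.+1 + m, m) = \sum_(0 <= j < m.+1) y j *+ 'C(k + j, j).
  have nablaMn j e : nabla (y j *+ e) = (y j - y j.+1) *+ e.
    by elim: e => [|e IHe]; rewrite ?mulr0n ?nabla0 // !mulrS nablaD nabla_y IHe.
  elim: m => [|m IHm].
    by rewrite !big_nat1 nablaMn !bin0 !mulr1n subrK.
  rewrite big_nat_recr //= [RHS]big_nat_recr //= -IHm nablaMn mulrnBl.
  rewrite -!addrA; congr (_ + _); rewrite addNr addr0 -mulrnDr.
  by rewrite [in RHS]addnC -addSnnS addnS binS.
rewrite !wE nabla_sum; set m := (p - k.+2)%N.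
have Dp : p = (m + k.+2)%N by rewrite subnK.
have -> : (p - k.+1)%N = m.+1 by rewrite Dp -addnBA // -[k.+2]addn1 addKn addn1.
under eq_bigr do rewrite addSn subn1 /=.
under [RHS]eq_bigr do rewrite addSn subn1 /=.
rewrite [RHS]big_nat_recr //= -abel -addrA -mulrnDr.
have -> : ('C(k.+1 + m, m) + 'C(k + m.+1, m.+1) = 'C(p, m.+1))%N.
  have -> : p = (k.+1 + m).+1 by rewrite [LHS]Dp addnC addSn.
  by rewrite -addSnnS binS addnC.
have /dvdnP[e ->] : (p %| 'C(p, m.+1))%N.
  by apply: prime_dvd_bin => //=; rewrite [ltnRHS]Dp !addnS !ltnS leq_addr.
by rewrite mulnC mulrnA row_pchar mul0rn addr0.
Qed.

(** The binomial divides (p-1)!, which is prime to p by Wilson's theorem. *)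
Let bin_predp_unit j : (j < p)%N -> ('C(p.-1, j)%:R * xi ^- j) \is a GRing.unit.
Proof.
move=> ltjp; rewrite unitrMl ?unitrV ?unitrX //.
apply: natr_mx_unit; rewrite -(dvdn_pcharf pF); apply/negP => p_bin.
have le_jp : (j <= p.-1)%N by rewrite -ltnS prednK.
have := Wilson (prime_gt1 p_pr); rewrite p_pr -(bin_fact le_jp) -addn1.
rewrite dvdn_addr ?dvdn_mulr // dvdn1 => /esym/eqP p1.
by move: (prime_gt1 p_pr); rewrite p1.
Qed.

Lemma wvec_coord_eq0 i (j : 'I_p) : (p - i < j)%N -> wvec i *m c j = 0.
Proof.
move=> lt_ij; rewrite /wvec mulmx_suml big_nat big1 // => k /= ltk.
have ltkj : (k < j)%N by apply: leq_ltn_trans lt_ij.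
have ltkp := ltn_trans ltkj (ltn_ord j).
rewrite -mulmxA (bc (Ordinal ltkp) j) -val_eqE /= ltn_eqF // raddf0 mulmx0 //.
Qed.

Lemma wvec_top i : (0 < i <= p)%N ->
  wvec i = \sum_(0 <= j < p - i) ('C(i + j - 1, j)%:R * xi ^- j) *m b j
    + ('C(p.-1, p - i)%:R * xi ^- (p - i)) *m b (p - i).
Proof.
by case/andP=> i_gt0 le_ip; rewrite /wvec big_nat_recr //= subnKC // subn1.
Qed.

Lemma wvec_coord_top i (j : 'I_p) : (0 < i <= p)%N -> val j = (p - i)%N ->
  wvec i *m c j = 'C(p.-1, j)%:R * xi ^- j.
Proof.
move=> ip Dj; rewrite wvec_top // -Dj mulmxDl -mulmxA bc eqxx mulmx1.
rewrite mulmx_suml big_nat big1 ?add0r // => k /= ltk.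
have ltkp := ltn_trans ltk (ltn_ord j).
by rewrite -mulmxA (bc (Ordinal ltkp) j) -val_eqE /= ltn_eqF ?raddf0 ?mulmx0.
Qed.

(** Triangularity: the last term of [wvec i] is a unit multiple of b_(p-i), so a larger i reaches
    less far. Reading coordinate p - i kills z_i once the earlier coefficients are known to
    vanish. *)
Lemma wvec_free k (z : nat -> 'M[F]_n.+1) : (k <= p)%N ->
    \sum_(1 <= i < k.+1) z i *m wvec i = 0 ->
  forall i, (0 < i <= k)%N -> z i = 0.
Proof.
move=> le_kp sum0; elim/ltn_ind=> i IHi /andP[i_gt0 le_ik].
have le_ip := leq_trans le_ik le_kp.
have lt_ip : (p - i < p)%N by rewrite ltn_subrL i_gt0.
pose j := Ordinal lt_ip; have := congr1 (mulmx^~ (c j)) sum0.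
rewrite mul0mx mulmx_suml (bigD1_seq i) ?iota_uniq ?mem_index_iota ?i_gt0 //=.
rewrite -mulmxA (wvec_coord_top (j := j)) ?i_gt0 // big_seq_cond big1 ?addr0.
  by move/(canRL (mulrK (bin_predp_unit lt_ip))); rewrite mul0r.
move=> i'; rewrite mem_index_iota ltnS => /andP[/andP[i'0 le_i'] neq].
have [lti|] := ltnP i' i; first by rewrite IHi ?i'0 // !mul0mx.
rewrite leq_eqVlt eq_sym (negPf neq) /= => lti.
rewrite -mulmxA (wvec_coord_eq0 (j := j)) ?mulmx0 //= ltn_sub2l //.
exact: leq_trans (leq_trans lti le_i') le_kp.
Qed.

Lemma Hhom_wvec X : Hhom X -> exists2 z : nat -> 'M[F]_n.+1,
  forall i, z i \in Delta & X = \sum_(1 <= i < p.+1) z i *m wvec i.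
Proof.
pose Sp X := exists2 z : nat -> 'M[F]_n.+1,
  forall i, z i \in Delta & X = \sum_(1 <= i < p.+1) z i *m wvec i.
have Sp0 : Sp 0.
  by exists (fun=> 0) => [i|]; rewrite ?rpred0 // big1 // => i _; rewrite mul0mx.
have SpD X1 X2 : Sp X1 -> Sp X2 -> Sp (X1 + X2).
  case=> z1 Dz1 -> [z2 Dz2 ->]; exists (fun i => z1 i + z2 i) => [i|].
    exact: rpredD.
  by rewrite -big_split; apply: eq_bigr => i _; rewrite mulmxDl.
have SpM f X1 : f \in Delta -> Sp X1 -> Sp (f *m X1).
  move=> Df [z Dz ->]; exists (fun i => f * z i) => [i|]; first exact: rpredM.
  by rewrite mulmx_sumr; apply: eq_bigr => i _; rewrite mulmxA.
have Sp_w i : (0 < i <= p)%N -> Sp (wvec i).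
  move=> ip; exists (fun j => (j == i)%:R) => [j|]; first exact: rpred_nat.
  rewrite (bigD1_seq i) ?iota_uniq ?mem_index_iota //= eqxx mul1mx.
  by rewrite big1 ?addr0 // => j /negPf->; rewrite mul0mx.
(* Solve for b_j in the top term of [wvec (p - j)]; its other terms involve only b_k with k < j. *)
have Sp_b j : (j < p)%N -> Sp (b j).
  elim/ltn_ind: j => j IHj lt_jp.
  have ip : (0 < p - j <= p)%N by rewrite subn_gt0 lt_jp leq_subr.
  have := wvec_top ip; rewrite subKn ?(ltnW lt_jp) //.
  set Y := \sum_(_ <= _ < _) _; set u := _ / _ => Dw.
  have uU : u \is a GRing.unit by apply: bin_predp_unit.
  rewrite -[b j](mulKmx uU); have -> : u *m b j = - 1%:M *m Y + wvec (p - j).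
    by rewrite Dw mulNmx mul1mx addKr.
  apply: (SpM); first by rewrite rpredV rpredM ?rpred_nat // rpredV rpredX.
  apply: (SpD); last exact: Sp_w.
  apply: (SpM); first by rewrite rpredN rpred1.
  rewrite /Y big_nat; apply: (big_ind Sp) => // k /= ltk; apply: (SpM).
    by rewrite rpredM ?rpred_nat // rpredV rpredX.
  by apply: IHj => //; apply: ltn_trans lt_jp.
move=> hX; rewrite (basis_expand cb X); apply: (big_ind Sp) => // i _.
by apply: (SpM _ _ (Hhom_coord bH bc cb i hX)); apply: Sp_b.
Qed.

Definition wsum k : 'M[F]_N := (\sum_(1 <= i < k.+1) <<wvec i>>)%MS.

Lemma wsum0 : wsum 0 = 0.
Proof. by rewrite /wsum big_geq. Qed.

Lemma wsumS k : wsum k.+1 = (wsum k + <<wvec k.+1>>)%MS.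
Proof. by rewrite /wsum big_nat_recr. Qed.

Lemma wsum_mono k l : (k <= l)%N -> (wsum k <= wsum l)%MS.
Proof.
elim: l => [|l IHl]; first by rewrite leqn0 => /eqP->.
rewrite leq_eqVlt => /orP[/eqP-> //|/IHl].
by rewrite wsumS => /submx_trans-> //; apply: addsmxSl.
Qed.

Lemma wvec_sub i k : (0 < i <= k)%N -> (wvec i <= wsum k)%MS.
Proof.
case/andP; case: i => // i _ le_ik; apply: submx_trans (wsum_mono le_ik).
by rewrite wsumS (submx_trans _ (addsmxSr _ _)) ?genmxE.
Qed.

Lemma nabla_wvec_sub i k : (0 < i <= p)%N -> (i <= k.+1)%N ->
  (nabla (wvec i) <= wsum k)%MS.
Proof.
case: i => [//|[|i]] /=; first by rewrite nabla_wvec1 sub0mx.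
by move=> lt_ip le_ik; rewrite nabla_wvecS ?wvec_sub.
Qed.

Lemma wsum_module k : (k <= p)%N -> mxmodule rG (wsum k).
Proof.
elim: k => [|k IHk] lt_kp; first by rewrite wsum0 mxmodule0.
apply/mxmoduleP; apply: G_ind => // [h Hh||x x2 Gx Gx2 xW x2W]; last first.
- by rewrite repr_mxM // mulmxA (submx_trans (submxMr _ xW)).
- rewrite wsumS addsmxMr addsmx_sub; apply/andP; split.
    apply: submx_trans (addsmxSl _ _).
    by have /mxmoduleP-> := IHk (ltnW lt_kp).
  rewrite (eqmxMr _ (genmxE _)) nabla_act mulmx_sub // -wsumS.
  by rewrite addmx_sub ?wvec_sub ?leqnn // eqmx_opp nabla_wvec_sub.
rewrite wsumS addsmxMr addsmx_sub; apply/andP; split.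
  apply: submx_trans (addsmxSl _ _).
  by have /mxmoduleP-> := IHk (ltnW lt_kp); rewrite ?(subsetP sHG).
rewrite (eqmxMr _ (genmxE _)) -wvecH // mulmx_sub // -wsumS.
by rewrite wvec_sub ?leqnn.
Qed.

Lemma wsum_sub X k : (X <= wsum k)%MS ->
  exists z : nat -> 'M[F]_n.+1, X = \sum_(1 <= i < k.+1) z i *m wvec i.
Proof.
elim: k X => [|k IHk] X.
  by rewrite wsum0 submx0 => /eqP->; exists (fun=> 0); rewrite big_geq.
rewrite wsumS => /sub_addsmxP[[u v] /= ->].
have [z ->] := IHk _ (submxMl u (wsum k)).
have /submxP[z' ->] : (v *m <<wvec k.+1>> <= wvec k.+1)%MS.
  by rewrite (submx_trans (submxMl _ _)) ?genmxE.
exists (fun i => if i == k.+1 then z' else z i).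
rewrite [RHS]big_nat_recr //= eqxx; congr (_ + _); apply: eq_big_nat => i.
by case/andP=> _ lt_ik; rewrite ltn_eqF.
Qed.

Lemma wvec_notin k : (k < p)%N -> ~~ (wvec k.+1 <= wsum k)%MS.
Proof.
move=> lt_kp; apply/negP => /wsum_sub[z Dw].
pose z' i := if i == k.+1 then -1 else z i.
have z'0 := @wvec_free k.+1 z' lt_kp.
have: z' k.+1 = 0; last first.
  by move/eqP; rewrite /z' eqxx oppr_eq0 oner_eq0.
apply: z'0; rewrite ?leqnn // big_nat_recr //= {2}/z' eqxx mulNmx mul1mx.
rewrite [in X in _ - X]Dw; apply/eqP; rewrite subr_eq0; apply/eqP.
by apply: eq_big_nat => i /andP[_ lt_ik]; rewrite /z' ltn_eqF.
Qed.

Lemma wsum_strict k : (k < p)%N -> (wsum k < wsum k.+1)%MS.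
Proof.
move=> lt_kp; rewrite /ltmx wsum_mono //=; apply: contra (wvec_notin lt_kp).
by apply: submx_trans; rewrite wvec_sub ?leqnn.
Qed.

Lemma wvec_act_sub k : (k < p)%N ->
  (wvec k.+1 *m rG a - gamma *m xi *m wvec k.+1 <= wsum k)%MS.
Proof.
move=> lt_kp; rewrite nabla_act mulmxBr addrAC subrr add0r eqmx_opp.
by rewrite mulmx_sub // nabla_wvec_sub.
Qed.

Lemma wsum_full : (1%:M <= wsum p)%MS.
Proof.
apply: (Hhom_generates sHG irrV p_pr bH bc cb (mxmodule1 rG)) => X /Hhom_wvec[z _ -> _].
rewrite big_nat; apply: summx_sub => i /andP[i_gt0 lt_ip].
by rewrite mulmx_sub // wvec_sub // i_gt0 -ltnS.
Qed.

(** S is stable under [nabla], which shifts the combination down by one index and keeps its leading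
    coefficient. By induction S contains the lower [wvec], and subtracting them isolates the top
    one. *)
Lemma wsum_sub_module (S : 'M[F]_N) k (z : nat -> 'M[F]_n.+1) :
    mxmodule rG S -> (k < p)%N -> (forall i, z i \in Delta) -> z k.+1 != 0 ->
    ((\sum_(1 <= i < k.+2) z i *m wvec i)%R <= S)%MS ->
  (wsum k.+1 <= S)%MS.
Proof.
move=> modS; elim: k z => [|k IHk] z lt_kp Dz nz_z sXS.
  rewrite wsumS wsum0 adds0mx genmxE.
  rewrite big_nat1 in sXS; rewrite -[wvec 1](mulKmx (endalg_unit irrV (Dz 1) nz_z)).
  by rewrite mulmx_sub.
have sWS : (wsum k.+1 <= S)%MS.
  apply: (IHk (fun i => z i.+1)) => //; first exact: ltnW.
  have := nabla_module modS sXS; rewrite nabla_sum big_nat_recl //=.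
  rewrite nablaM // nabla_wvec1 mulmx0 add0r => {}sXS.
  rewrite (eq_big_nat _ _ (F2 := fun i => nabla (z i.+1 *m wvec i.+1))) //.
  move=> i /andP[i_gt0 lt_i].
  by rewrite nablaM // nabla_wvecS // i_gt0 (leq_trans lt_i).
rewrite wsumS addsmx_sub sWS genmxE.
rewrite -[wvec _](mulKmx (endalg_unit irrV (Dz _) nz_z)) mulmx_sub //.
rewrite big_nat_recr //= in sXS.
set Y := \sum_(_ <= _ < _) _ in sXS; have sYS : (Y <= S)%MS.
  apply: submx_trans sWS; rewrite /Y big_nat; apply: summx_sub => i ik.
  by rewrite mulmx_sub // wvec_sub.
by rewrite -[X in (X <= _)%MS](addKr Y) addmx_sub // eqmx_opp.
Qed.

(** For the largest k with [wsum k] inside S, [wsum_sub_module] bounds by k the last nonzero index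
    of any FH-homomorphism into S. *)
Lemma module_wsum (S : 'M[F]_N) :
  mxmodule rG S -> exists2 k, (k <= p)%N & (S :=: wsum k)%MS.
Proof.
move=> modS; pose P k := (k <= p)%N && (wsum k <= S)%MS.
have exP : exists k, P k by exists 0; rewrite /P wsum0 sub0mx.
have ubP k : P k -> (k <= p)%N by case/andP.
have [k /andP[le_kp sWS] maxk] := ex_maxnP exP ubP.
exists k => //; apply/eqmxP; rewrite sWS andbT.
apply: (Hhom_generates sHG irrV p_pr bH bc cb modS) => X /Hhom_wvec[z Dz DX] sXS.
pose Q i := [&& (0 < i)%N, (i <= p)%N & z i != 0].
have ubQ i : Q i -> (i <= p)%N by case/and3P.
have [/existsP[i0 Qi0]|noQ] := boolP [exists i : 'I_p.+1, Q i]; last first.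
  rewrite DX big_nat big1 ?sub0mx // => i /andP[i_gt0 lt_ip].
  have [->|nz] := eqVneq (z i) 0; first by rewrite mul0mx.
  by case/existsP: noQ; exists (Ordinal lt_ip); apply/and3P; split.
have [i /and3P[i_gt0 le_ip nz_zi] maxi] := ex_maxnP (ex_intro Q _ Qi0) ubQ.
have {}DX : X = \sum_(1 <= j < i.+1) z j *m wvec j.
  rewrite DX (big_cat_nat _ (n := i.+1)) //=; set Y := (X in _ + X).
  suffices -> : Y = 0 by rewrite addr0.
  rewrite /Y big_nat big1 // => j /andP[lt_ij lt_jp].
  have [->|nz] := eqVneq (z j) 0; first by rewrite mul0mx.
  have: (j <= i)%N by apply: maxi; rewrite /Q nz (leq_trans _ lt_ij) // andbT.
  by rewrite leqNgt lt_ij.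
have sWi : (wsum i <= S)%MS.
  case: i i_gt0 le_ip nz_zi {maxi} DX => // i _ le_ip nz_zi DX.
  by apply: (@wsum_sub_module S i z); rewrite -?DX.
apply: (@submx_trans _ _ _ _ _ _ (wsum i)).
  rewrite DX big_nat; apply: summx_sub => j ij.
  by rewrite mulmx_sub // wvec_sub.
by apply: wsum_mono; apply: maxk; rewrite /P le_ip.
Qed.

Lemma wsum_lt k l : (wsum k < wsum l)%MS -> (k < l)%N.
Proof.
by rewrite ltnNge; apply: contraL => /wsum_mono sW; rewrite /ltmx sW andbF.
Qed.

Lemma wsum_uniserial : uniserial rG.
Proof.
move=> U W /module_wsum[k _ defU] /module_wsum[l _ defW].
rewrite !defU !defW.
by case/orP: (leq_total k l) => /wsum_mono; [left | right].
Qed.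

Lemma wsum_max_submod k : (k < p)%N -> max_submod rG (wsum k) (wsum k.+1).
Proof.
move=> lt_kp; split=> [|S [/module_wsum[l le_lp defS]]]; first exact: wsum_strict.
rewrite !(lt_eqmx defS) => /wsum_lt lt_kl /wsum_lt lt_lk.
by have := leq_trans lt_lk lt_kl; rewrite ltnn.
Qed.

Lemma wsum_series_nth k : (k <= p)%N ->
  (0 :: [seq wsum i | i <- iota 1 p])`_k = wsum k.
Proof.
move=> le_kp; have -> : 0 :: [seq wsum i | i <- iota 1 p] = map wsum (iota 0 p.+1).
  by rewrite /= wsum0.
by rewrite (nth_map 0) ?size_iota // nth_iota.
Qed.

Lemma wsum_composition_series :
  mx_composition_series rG [seq wsum k | k <- iota 1 p].
Proof.
split=> [|k]; last first.
  rewrite size_map size_iota => lt_kp; have := wsum_max_submod lt_kp.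
  by rewrite -(wsum_series_nth lt_kp) -(wsum_series_nth (ltnW lt_kp)).
apply/allP=> S /mapP[k]; rewrite mem_iota add1n ltnS => /andP[_ le_kp] ->.
exact: wsum_module.
Qed.

(** Each term is some [wsum l], and maximality of the preceding term forbids skipping an index. *)
Lemma composition_series_wsum Us : mx_composition_series rG Us ->
  forall k, (k < size Us)%N -> (k < p)%N /\ (Us`_k :=: wsum k.+1)%MS.
Proof.
case=> modUs maxUs; elim=> [|k IHk] lt_k.
  have [ltU maxU] := maxUs 0 lt_k; rewrite /= in ltU maxU.
  have [l le_lp defU] := module_wsum (mx_subseries_module 0 modUs).
  rewrite (lt_eqmx defU) -wsum0 in ltU; have lt0l := wsum_lt ltU.
  case: l lt0l le_lp defU {ltU} => // -[//|l] _ lt_lp defU.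
  case: (maxU (wsum 1)); split.
  - by rewrite wsum_module // ltnW.
  - by rewrite -wsum0 wsum_strict // (ltn_trans _ lt_lp).
  rewrite (lt_eqmx defU); apply: ltmx_sub_trans (wsum_strict _) (wsum_mono _) => //.
  exact: leq_ltn_trans lt_lp.
have [lt_kp defUk] := IHk (ltnW lt_k).
have [ltU maxU] := maxUs k.+1 lt_k; rewrite /= in ltU maxU.
have [l le_lp defU] := module_wsum (mx_subseries_module k.+1 modUs).
rewrite (lt_eqmx defUk) (lt_eqmx defU) in ltU; have lt_kl := wsum_lt ltU.
split; first exact: leq_trans le_lp.
move: lt_kl; rewrite leq_eqVlt => /orP[/eqP-> //|lt_kl].
case: (maxU (wsum k.+2)); split.
- by rewrite wsum_module // ltnW // (leq_trans lt_kl).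
- by rewrite (lt_eqmx defUk) wsum_strict // (leq_trans _ le_lp) // ltnW.
rewrite (lt_eqmx defU); apply: ltmx_sub_trans (wsum_strict _) (wsum_mono _) => //.
exact: leq_trans le_lp.
Qed.

Lemma composition_series_size Us : mx_composition_series rG Us ->
  (last 0 Us :=: 1%:M)%MS -> size Us = p.
Proof.
move=> compU lastU; have := composition_series_wsum compU.
have b0 := basis_neq0 bc (Ordinal p_gt0).
case: (lastP Us) lastU => [|Us' U] lastU; last first.
  rewrite last_rcons in lastU; move/(_ (size Us')).
  rewrite size_rcons nth_rcons ltnn eqxx => /(_ (leqnn _))[lt_p defU].
  apply/eqP; rewrite eqn_leq lt_p leqNgt; apply/negP => /wsum_strict.
  by rewrite /ltmx andbC -(defU) lastU submx1.
have : (1%:M <= (0 : 'M[F]_N))%MS by rewrite -lastU.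
by rewrite submx0 => /eqP one0; case/eqP: b0; rewrite -[b _]mulmx1 one0 mulmx0.
Qed.

End Modular.

(** * Conjugacy in Delta of the roots of an irreducible central polynomial *)

Lemma polyOver_divmod (R : nzRingType) (S : subringClosed R) (f g : {poly R}) :
    f \is a polyOver S -> g \is a polyOver S -> g \is monic ->
  exists q r : {poly R}, [/\ q \is a polyOver S, r \is a polyOver S,
    f = q * g + r & (size r < size g)%N].
Proof.
move=> Sf Sg mon_g; have [m] := ubnP (size f).
elim: m f Sf => // m IHm f Sf; rewrite ltnS => le_fm.
have g_gt0 : (0 < size g)%N by rewrite size_poly_gt0 monic_neq0.
have [lt_fg|le_gf] := ltnP (size f) (size g).
  by exists 0, f; rewrite rpred0 mul0r add0r.
pose h := (lead_coef f)%:P * 'X^(size f - size g).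
have Sh : h \is a polyOver S.
  by rewrite rpredM ?polyOverC ?rpredX ?polyOverX // lead_coefE (polyOverP Sf).
have f_neq0 : f != 0 by rewrite -size_poly_gt0 (leq_trans g_gt0).
have f_gt0 : (0 < size f)%N by rewrite size_poly_gt0.
have lt_f'm : (size (f - h * g)%R < m)%N.
  apply: leq_trans le_fm; rewrite -(ltn_predK f_gt0) ltnS.
  apply/leq_sizeP=> j le_fj; set e := (size f - size g)%N in h Sh *.
  have le_ej : (e <= j)%N.
    by apply: leq_trans le_fj; rewrite -ltnS prednK // ltn_subrL g_gt0.
  rewrite coefB /h -mulrA coefCM -commr_polyXn coefMXn ltnNge le_ej /=.
  have [->|neq_j] := eqVneq j (size f).-1.
    have -> : ((size f).-1 - e)%N = (size g).-1.
      by rewrite -predn_sub subKn.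
    by rewrite -!lead_coefE (monicP mon_g) mulr1 subrr.
  have lt_fj : (size f <= j)%N.
    by rewrite -(ltn_predK f_gt0) ltn_neqAle eq_sym neq_j.
  rewrite !nth_default ?mulr0 ?subr0 // leq_subRL //.
  by rewrite subnK.
have [q [r [Sq Sr Df lt_r]]] := IHm _ (rpredB Sf (rpredM Sh Sg)) lt_f'm.
exists (h + q), r; split=> //; first exact: rpredD.
by rewrite mulrDl -addrA -Df addrC subrK.
Qed.

Section SkolemNoether.

Variables (F : fieldType) (gT : finGroupType) (H : {group gT}) (n : nat).
Variable rV : mx_representation F H n.+1.
Hypothesis irrV : mx_irreducible rV.
Local Notation Delta := (endalg rV).
Local Notation Z := (endcenter rV).
Variables (theta : 'M[F]_n.+1).
Hypothesis Dtheta : theta \in Delta.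
Implicit Types f g : {poly 'M[F]_n.+1}.

(** The right action of f on d, where s acts on Delta as left multiplication by theta and constants
    act by right multiplication. *)
Let Phi d f := \sum_(i < size f) theta ^+ i * d * f`_i.

Let Phi_wide k d f : (size f <= k)%N -> Phi d f = \sum_(i < k) theta ^+ i * d * f`_i.
Proof.
move=> le_fk; rewrite /Phi (big_ord_widen _ (fun i => theta ^+ i * d * f`_i) le_fk).
rewrite big_mkcond; apply: eq_bigr => i _; case: ltnP => // le_fi.
by rewrite nth_default ?mulr0.
Qed.

Let PhiD d f g : Phi d (f + g) = Phi d f + Phi d g.
Proof.
rewrite !(@Phi_wide (maxn (size f) (size g))) ?leq_maxl ?leq_maxr ?size_polyD //.
by rewrite -big_split; apply: eq_bigr => i _; rewrite coefD mulrDr.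
Qed.

Let Phi0 d : Phi d 0 = 0.
Proof. by rewrite /Phi size_poly0 big_ord0. Qed.

Let PhiN d f : Phi d (- f) = - Phi d f.
Proof. by apply/eqP; rewrite -addr_eq0 -PhiD addNr Phi0. Qed.

Let PhiMC d f x : Phi d (f * x%:P) = Phi d f * x.
Proof.
rewrite (@Phi_wide (size f)); last first.
  by apply/leq_sizeP=> j le_fj; rewrite coefMC nth_default ?mul0r.
by rewrite mulr_suml; apply: eq_bigr => i _; rewrite coefMC mulrA.
Qed.

Let PhiCM d f x : Phi d (x%:P * f) = Phi (d * x) f.
Proof.
rewrite (@Phi_wide (size f)); last first.
  by apply/leq_sizeP=> j le_fj; rewrite coefCM nth_default ?mulr0.
by apply: eq_bigr => i _; rewrite coefCM !mulrA.
Qed.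

Let PhiMX d f : Phi d (f * 'X) = theta * Phi d f.
Proof.
rewrite (@Phi_wide (size f).+1); last first.
  by apply/leq_sizeP=> -[|j] //; rewrite coefMX /= => ltj; rewrite nth_default.
rewrite big_ord_recl coefMX /= mulr0 add0r mulr_sumr; apply: eq_bigr => i _.
by rewrite coefMX /= exprS !mulrA.
Qed.

(* The polynomials f with [\sum_i theta^i d f_i = 0] for all d in Delta form  *)
(* a two-sided ideal of Delta[s].                                             *)
Let J f := f \is a polyOver Delta /\ forall d, d \in Delta -> Phi d f = 0.

Let JB f g : J f -> J g -> J (f - g).
Proof.
case=> Df Jf [Dg Jg]; split=> [|d Dd]; first exact: rpredB.
by rewrite PhiD PhiN Jf // Jg // subrr.
Qed.

Let JMC f x : J f -> x \in Delta -> J (f * x%:P).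
Proof.
case=> Df Jf Dx; split=> [|d Dd]; first by rewrite rpredM ?polyOverC.
by rewrite PhiMC Jf // mul0r.
Qed.

Let JCM f x : J f -> x \in Delta -> J (x%:P * f).
Proof.
case=> Df Jf Dx; split=> [|d Dd]; first by rewrite rpredM ?polyOverC.
by rewrite PhiCM Jf // rpredM.
Qed.

Let JM g f : J f -> g \is a polyOver Delta -> J (g * f).
Proof.
move=> Jf Dg; split=> [|d Dd]; first by case: Jf => Df _; rewrite rpredM.
rewrite -[g]coefK poly_def mulr_suml.
rewrite (big_morph (Phi d) (PhiD d) (Phi0 d)) big1 // => i _.
rewrite -mul_polyC -mulrA PhiCM -commr_polyXn.
have: d * g`_i \in Delta by rewrite rpredM // (polyOverP Dg).
case: Jf => _ Jf /Jf; move: (d * g`_i) => e Phi_e.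
elim: (i : nat) => [|k IHk]; first by rewrite mulr1.
by rewrite exprSr mulrA PhiMX IHk mulr0.
Qed.

Variable mu : {poly 'M[F]_n.+1}.
Hypothesis mon_mu : mu \is monic.
Hypothesis irr_mu : irreducible_over Z mu.
Hypothesis mu_theta : root mu theta.

Let Zmu : mu \is a polyOver Z. Proof. by case: irr_mu. Qed.

Let polyZD f : f \is a polyOver Z -> f \is a polyOver Delta.
Proof.
by move/polyOverP=> Zf; apply/polyOverP=> i; apply: endcenter_sub.
Qed.

Let J_mu : J mu.
Proof.
split=> [|d Dd]; first exact: polyZD.
have -> : Phi d mu = mu.[theta] * d; last by rewrite (rootP mu_theta) mul0r.
rewrite horner_coef mulr_suml; apply: eq_bigr => i _.
have /endcenterP[Dmui cmu] := polyOverP Zmu i.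
have Dtd : theta ^+ i * d \in Delta by rewrite rpredM ?rpredX.
by rewrite -cmu // mulrA.
Qed.

(** A nonzero element of least degree in the ideal, made monic, has central coefficients and divides
    mu. By irreducibility it has the degree of mu or is the constant 1, and 1 is not in the
    ideal. *)
Let J_min f : J f -> f != 0 -> (size mu <= size f)%N.
Proof.
have [m] := ubnP (size f); elim: m f => // m IHm f; rewrite ltnS => le_fm Jf nz_f.
rewrite leqNgt; apply/negP => lt_fmu.
have minf g : J g -> (size g < size f)%N -> g = 0.
  move=> Jg lt_gf; apply/eqP/wlog_neg => nz_g.
  have := IHm g (leq_trans lt_gf le_fm) Jg nz_g.
  by rewrite leqNgt (ltn_trans lt_gf lt_fmu).
have nz_lf : lead_coef f != 0 by rewrite lead_coef_eq0.
have Dlf : lead_coef f \in Delta.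
  by rewrite lead_coefE; case: Jf => /polyOverP.
have Ulf := endalg_unit irrV Dlf nz_lf.
pose c := f * ((lead_coef f)^-1)%:P.
have Jc : J c by apply: JMC; rewrite ?rpredV.
have cE i : c`_i = f`_i / lead_coef f by rewrite coefMC.
have c_top : c`_(size f).-1 = 1 by rewrite cE -lead_coefE mulrV.
have le_cf : (size c <= size f)%N.
  by apply/leq_sizeP=> j le_fj; rewrite cE nth_default ?mul0r.
have size_c : size c = size f.
  apply/eqP; rewrite eqn_leq le_cf -(@prednK (size f)) ?size_poly_gt0 //.
  rewrite ltnNge; apply/negP => /leq_sizeP/(_ _ (leqnn _)).
  by rewrite c_top => /eqP; rewrite oner_eq0.
have mon_c : c \is monic by apply/monicP; rewrite lead_coefE size_c.
(* The commutator of c with a constant of Delta lies in the ideal and loses its top coefficient, so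
   it vanishes by minimality. *)
have Zc : c \is a polyOver Z.
  apply/polyOverP=> i; apply/endcenterP.
  split=> [|d Dd]; first by case: Jc => /polyOverP.
  apply/eqP; rewrite -subr_eq0 -coefMC -coefCM -coefB.
  suffices -> : c * d%:P - d%:P * c = 0 by rewrite coef0.
  apply: minf; first by apply: JB; [apply: JMC | apply: JCM].
  rewrite -[size f](@prednK _) ?size_poly_gt0 // ltnS.
  apply/leq_sizeP=> j le_fj; rewrite coefB coefMC coefCM.
  have [->|neq_j] := eqVneq j (size f).-1.
    by rewrite c_top mulr1 mul1r subrr.
  rewrite nth_default ?mul0r ?mulr0 ?subr0 // size_c.
  by rewrite -[size f](@prednK _) ?size_poly_gt0 // ltn_neqAle eq_sym neq_j.
have [q [r [Zq Zr Dmu lt_rc]]] := polyOver_divmod Zmu Zc mon_c.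
have r0 : r = 0.
  apply: minf; last by rewrite -size_c.
  have -> : r = mu - q * c by rewrite Dmu addrC addKr.
  by apply: JB => //; apply: JM => //; apply: polyZD.
rewrite r0 addr0 in Dmu.
have [_ _ /(_ q c Zq Zc Dmu)[size_q|size_c1]] := irr_mu.
  have nz_q : q != 0 by rewrite -size_poly_gt0 size_q.
  by move: lt_fmu; rewrite Dmu size_Mmonic // size_q add1n /= size_c ltnn.
case: Jc => _ /(_ 1 (rpred1 _)); rewrite /Phi size_c1 big_ord1 expr0 !mul1r.
have c0 : c`_0 = 1 by move: c_top; rewrite -size_c size_c1.
by rewrite c0 => /eqP; rewrite oner_eq0.
Qed.

(** Write mu = c (s - theta'). The degree of c is too small for the ideal, so e = Phi d c is nonzero
    for some d, and theta e - e theta' = Phi d mu = 0. *)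
Lemma conjugate_roots theta' : theta' \in Delta -> root mu theta' ->
  exists d, [/\ d \in Delta, d \is a GRing.unit & theta * d = d * theta'].
Proof.
move=> Dtheta' mu_theta'; have Dmu := polyZD Zmu.
have DX : 'X - theta'%:P \is a polyOver Delta.
  by rewrite rpredB ?polyOverX ?polyOverC.
have [c [r [Dc _ Emu]]] := polyOver_divmod Dmu DX (monicXsubC _).
rewrite size_XsubC ltnS => /size1_polyC Dr.
have r0 : r = 0.
  move/rootP: mu_theta'; rewrite Emu hornerD Dr hornerC hornerM_comm.
    by rewrite hornerXsubC subrr mulr0 add0r => ->; rewrite polyC0.
  by rewrite /comm_poly hornerXsubC subrr mulr0 mul0r.
rewrite {r Dr}r0 addr0 in Emu.
have nz_c : c != 0.
  apply: contraTneq mon_mu => c0.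
  by rewrite Emu c0 mul0r monicE lead_coef0 eq_sym oner_eq0.
have [d [Dd nz]] : exists d, d \in Delta /\ Phi d c <> 0.
  apply: NNPP => no_d; have: J c.
    split=> // d Dd; apply: NNPP => nz; apply: no_d; by exists d.
  move/J_min/(_ nz_c); rewrite Emu size_Mmonic ?monicXsubC // size_XsubC.
  by rewrite addn2 /= ltnn.
have D_Phi : Phi d c \in Delta.
  apply: rpred_sum => i _; rewrite rpredM ?(polyOverP Dc) // rpredM ?rpredX //.
exists (Phi d c); split=> //; first by apply: (endalg_unit irrV D_Phi); apply/eqP.
apply/eqP; rewrite -subr_eq0 -PhiMX -PhiMC -PhiN -PhiD -mulrBr -Emu.
by case: J_mu => _ ->.
Qed.

End SkolemNoether.

(** * Characteristic different from p: eigenvectors and homogeneous components *)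

Section Ordinary.
Variables (F : fieldType) (gT : finGroupType) (G H : {group gT}).
Hypothesis sHG : H \subset G.
Variables (a : gT) (n N : nat).
Hypothesis aG : a \in G.
Hypothesis G_ind : forall Q : gT -> Prop,
    (forall h, h \in H -> Q h) -> Q a ->
    (forall x y, x \in G -> y \in G -> Q x -> Q y -> Q (x * y)%g) ->
  forall g, g \in G -> Q g.
Variables (rV : mx_representation F H n.+1) (rG : mx_representation F G N).
Hypothesis irrV : mx_irreducible rV.
Variable gamma : 'M[F]_n.+1.
Hypothesis gammaU : gamma \is a GRing.unit.
Hypothesis gammaC : forall f, f \in endalg rV -> f * gamma = gamma * f.
Local Notation Delta := (endalg rV).
Local Notation Z := (endcenter rV).
Local Notation Hhom := (Hhom rV rG).
Local Notation rH := (subg_repr rG sHG).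
Variables (p : nat) (p_pr : prime p).
Variables (b : nat -> 'M[F]_(n.+1, N)) (c : nat -> 'M[F]_(N, n.+1)).
Hypothesis bH : forall i, Hhom (b i).
Hypothesis bS : forall i, b i *m rG a = gamma *m b i.+1.
Hypothesis bc : forall i j : 'I_p, b i *m c j = (i == j)%:R%:M.
Hypothesis cb : \sum_(i < p) c i *m b i = 1%:M.
Implicit Types (X Y : 'M[F]_(n.+1, N)).
Variables (xi : 'M[F]_n.+1).
Hypotheses (xiZ : xi \in Z) (xiU : xi \is a GRing.unit).
Hypothesis bp : b p = xi ^+ p *m b 0.

Let p_gt0 := prime_gt0 p_pr.
Let xiD : xi \in Delta := endcenter_sub xiZ.
Let xiC f : f \in Delta -> GRing.comm xi f.
Proof. by case/endcenterP: xiZ => _; apply. Qed.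

Definition uvec (theta : 'M[F]_n.+1) := \sum_(i < p) theta ^- i *m b i.

Lemma uvecH theta : theta \in Delta -> Hhom (uvec theta).
Proof.
by move=> Dt; apply: Hhom_sum => i _; apply: HhomM; rewrite ?rpredV ?rpredX.
Qed.

Lemma uvec_neq0 theta : uvec theta != 0.
Proof.
have := basis_coord bc (fun i => theta ^- i) (Ordinal p_gt0).
rewrite /= expr0 invr1 -/(uvec theta) => u1.
by apply: contra_eqN u1 => /eqP->; rewrite mul0mx eq_sym oner_eq0.
Qed.

(** Multiplication by theta shifts the terms cyclically; the last one wraps around since theta^-p
    b_p = b_0. *)
Lemma uvec_act theta : theta \in Delta -> theta ^+ p = xi ^+ p ->
  uvec theta *m rG a = gamma *m theta *m uvec theta.
Proof.
move=> Dt tX; have tU : theta \is a GRing.unit.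
  by rewrite -(unitrX_pos theta p_gt0) tX unitrX.
rewrite /uvec mulmx_suml -(mulmxA gamma) [theta *m _]mulmx_sumr.
pose f i := theta ^- i *m b i.
have fS i : theta *m f i.+1 = theta ^- i *m b i.+1.
  by rewrite /f mulmxA mulmxE exprSr invrM ?unitrX // mulrA mulrV // mul1r.
have fp : f p = f 0.
  by rewrite /f bp mulmxA mulmxE tX mulVr ?unitrX // expr0 invr1.
transitivity (gamma *m \sum_(i < p) theta *m f i.+1).
  rewrite mulmx_sumr; apply: eq_bigr => i _.
  rewrite fS -mulmxA bS !mulmxA !mulmxE; congr (_ *m _).
  by rewrite gammaC // rpredV rpredX.
congr (_ *m _); rewrite -!mulmx_sumr; congr (_ *m _).
case: (p) p_gt0 fp => // q _ fp; rewrite big_ord_recr [RHS]big_ord_recl /= fp.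
by rewrite addrC.
Qed.

Variable omega : 'M[F]_n.+1.
Hypotheses (omegaD : omega \in Delta) (omegaX : omega ^+ p = 1).
Hypotheses (omega1 : omega != 1) (pF : p \notin [pchar F]).

Local Notation th l := (xi * omega ^+ l).

Let omegaU : omega \is a GRing.unit.
Proof. by rewrite -(unitrX_pos omega p_gt0) omegaX unitr1. Qed.

Let pF0 : (p%:R : F) != 0.
Proof. by apply: contra pF => p0; rewrite inE p_pr. Qed.

Lemma th_endalg l : th l \in Delta.
Proof. by rewrite rpredM ?rpredX. Qed.

Lemma th_expp l : th l ^+ p = xi ^+ p.
Proof.
rewrite exprMn_comm; last by apply: xiC; rewrite rpredX.
by rewrite -exprM mulnC exprM omegaX expr1n mulr1.
Qed.

Let thU l : th l \is a GRing.unit.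
Proof. by rewrite unitrMl ?unitrX. Qed.

Lemma geometric_sum zeta : zeta \in Delta -> zeta ^+ p = 1 -> zeta != 1 ->
  \sum_(k < p) zeta ^+ k = 0.
Proof.
move=> Dz zX z1; have := subrX1 zeta p; rewrite zX subrr => /esym.
have D1 : zeta - 1 \in Delta by rewrite rpredB ?rpred1.
by case/(endalg_mulf_eq0 irrV D1) => // /eqP; rewrite subr_eq0 (negPf z1).
Qed.

Let omega_prim : p.-primitive_root omega.
Proof.
have [m prim_m dvd_m] := prim_order_exists p_gt0 omegaX.
move: dvd_m; have /primeP[_ H1] := p_pr; move/H1 => /orP[]/eqP Dm.
  by case/eqP: omega1; have := prim_expr_order prim_m; rewrite Dm expr1.
by rewrite -Dm.
Qed.

Let omega_div_eq1 (i j : 'I_p) : (omega ^- i * omega ^+ j == 1) = (i == j).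
Proof.
have Ui : omega ^+ i \is a GRing.unit by rewrite unitrX.
rewrite -(inj_eq (mulrI Ui)) mulrA mulrV // mul1r mulr1 (eq_prim_root_expr omega_prim).
by rewrite !modn_small // eq_sym.
Qed.

Let omega_div_expp i j : (omega ^- i * omega ^+ j) ^+ p = 1.
Proof.
rewrite exprMn_comm; last first.
  by apply/commr_sym/commrV/commrX/commr_sym/commrX.
by rewrite exprVn -!exprM ![(_ * p)%N]mulnC !exprM omegaX !expr1n invr1 mulr1.
Qed.

Let omega_div_endalg i j : omega ^- i * omega ^+ j \in Delta.
Proof. by rewrite rpredM ?rpredV ?rpredX. Qed.

Let omega_sum (i j : 'I_p) :
  \sum_(k < p) (omega ^- i * omega ^+ j) ^+ k = (p * (i == j))%:R.
Proof.
have [->|neq_ij] := eqVneq i j; last first.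
  by rewrite geometric_sum // ?omega_div_eq1 // muln0.
rewrite muln1; under eq_bigr do rewrite mulVr ?unitrX // expr1n.
by rewrite sumr_const card_ord.
Qed.

Let th_div j l : (th j)^-1 * th l = omega ^- j * omega ^+ l.
Proof. by rewrite invrM ?unitrX // -mulrA mulKr. Qed.

Let th_comm j l : GRing.comm (th j) (th l).
Proof.
apply: commrM; first by apply/commr_sym/xiC/th_endalg.
apply/commr_sym/commrM; first by apply/commr_sym/xiC; rewrite rpredX.
by apply/commrX/commr_sym/commrX.
Qed.

Lemma th_inj (j l : 'I_p) : th j = th l -> j = l.
Proof.
move=> eq_th; apply/eqP; rewrite -omega_div_eq1 -th_div -eq_th mulVr //.
Qed.

(** The Fourier transform of the coordinates c_k, dual to the eigenvectors by orthogonality of the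
    powers of omega. *)
Definition ucoord l := p%:R^-1 *: \sum_(k < p) c k *m th l ^+ k.

Lemma uvec_ucoord (j l : 'I_p) : uvec (th j) *m ucoord l = (j == l)%:R%:M.
Proof.
rewrite /ucoord -scalemxAr mulmx_sumr.
under eq_bigr => k _.
  rewrite mulmxA (basis_coord bc (fun i => th j ^- i)) mulmxE -exprVn.
  rewrite -exprMn_comm; last by apply/commr_sym/commrV/th_comm.
  rewrite th_div; over.
rewrite omega_sum natrM mulr_natl -scaler_nat scalerA mulVf // scale1r.
by case: eqP => _; rewrite ?mulr1n ?mulr0n // raddf0.
Qed.

Let th_sum (k i : 'I_p) :
  \sum_(l < p) th l ^+ k *m th l ^- i = (p%:R * (k == i)%:R)%:M.
Proof.
have omega_comm e f : GRing.comm (omega ^+ e) (omega ^- f).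
  by apply/commrV/commrX/commr_sym/commrX.
transitivity (xi ^+ k * xi ^- i * \sum_(l < p) (omega ^- i * omega ^+ k) ^+ l).
  rewrite mulr_sumr; apply: eq_bigr => l _; rewrite mulmxE.
  rewrite !(exprMn_comm _ (xiC (rpredX l omegaD))) invrM ?unitrX //.
  rewrite -mulrA [X in _ * X]mulrA -[RHS]mulrA; congr (_ * _).
  have -> : omega ^+ l ^+ k / omega ^+ l ^+ i / xi ^+ i
      = xi ^- i * (omega ^+ l ^+ k / omega ^+ l ^+ i).
    apply/commrV/commrX/commr_sym/xiC.
    by rewrite rpredM ?rpredV ?rpredX.
  congr (_ * _); rewrite exprMn_comm; last exact/commr_sym/omega_comm.
  by rewrite exprVn -!exprM ![(l * _)%N]mulnC omega_comm.
rewrite omega_sum; have [->|neq] := eqVneq k i.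
  by rewrite muln1 mulr1 mulrV ?unitrX // mul1r -[RHS]scalemx1 scaler_nat.
by rewrite muln0 !mulr0 raddf0.
Qed.

Lemma sum_ucoord : \sum_(l < p) ucoord l *m uvec (th l) = 1%:M.
Proof.
under eq_bigr => l _.
  rewrite /ucoord -scalemxAl mulmx_suml; under eq_bigr => k _.
    rewrite /uvec mulmx_sumr; under eq_bigr do rewrite mulmxA -(mulmxA (c k)).
    over.
  over.
rewrite -scaler_sumr exchange_big /= -cb scaler_sumr; apply: eq_bigr => k _.
rewrite exchange_big /= (bigD1 k) //= [X in _ + X]big1 => [|i neq].
  rewrite addr0 -mulmx_suml -mulmx_sumr th_sum eqxx mulr1 mul_mx_scalar.
  by rewrite -scalemxAl scalerA mulVf // scale1r.
rewrite -mulmx_suml -mulmx_sumr th_sum eq_sym (negPf neq) mulr0 raddf0.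
by rewrite mulmx0 mul0mx.
Qed.

Lemma uvec_expand m (X : 'M[F]_(m, N)) :
  X = \sum_(l < p) (X *m ucoord l) *m uvec (th l).
Proof. exact: (basis_expand (b := fun l => uvec (th l)) sum_ucoord). Qed.

Lemma sum_uvec_coord m (x : nat -> 'M[F]_(m, n.+1)) (l : 'I_p) :
  (\sum_(i < p) x i *m uvec (th i)) *m ucoord l = x l.
Proof. exact: (basis_coord (b := fun l => uvec (th l)) uvec_ucoord). Qed.

(** Inverse Fourier transform, obtained for every natural k by letting [a] act repeatedly on the
    case k = 0. *)
Lemma basis_uvec k :
  b k = p%:R^-1 *: \sum_(l < p) th l ^+ k *m uvec (th l).
Proof.
elim: k => [|k IHk].
  rewrite [LHS]uvec_expand scaler_sumr; apply: eq_bigr => l _.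
  rewrite scalemxAl; congr (_ *m _); rewrite /ucoord -scalemxAr; congr (_ *: _).
  rewrite mulmx_sumr (bigD1 (Ordinal p_gt0)) //= big1 => [|i neq].
    by rewrite mulmxA (bc (Ordinal p_gt0) (Ordinal p_gt0)) eqxx mul1mx addr0.
  by rewrite mulmxA (bc (Ordinal p_gt0) i) eq_sym (negPf neq) raddf0 mul0mx.
have -> : b k.+1 = gamma^-1 *m (b k *m rG a).
  by rewrite bS mulmxA mulmxE mulVr // mul1mx.
rewrite IHk -scalemxAl -scalemxAr; congr (_ *: _).
rewrite mulmx_suml mulmx_sumr; apply: eq_bigr => l _.
rewrite -mulmxA uvec_act ?th_endalg ?th_expp // !mulmxA !mulmxE; congr (_ *m _).
have Dt : th l ^+ k \in Delta by rewrite rpredX ?th_endalg.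
by rewrite -(mulrA gamma^-1) gammaC // !mulrA mulVr // mul1r -mulrA -exprSr.
Qed.

Lemma mxdirect_dual (r : nat) (B : 'I_r -> 'M[F]_(n.+1, N))
    (C : 'I_r -> 'M[F]_(N, n.+1)) :
  (forall i j, B i *m C j = (i == j)%:R%:M) ->
  mxdirect (\sum_(i < r) <<B i>>)%MS.
Proof.
move=> BC; apply/mxdirect_sumsP=> i _; apply/eqP/rowV0P => v.
rewrite sub_capmx genmxE => /andP[/submxP[w ->]] sumv.
have: w *m B i *m C i = 0.
  apply/sub_kermxP; apply: submx_trans sumv _; apply/sumsmx_subP => j neq_ji.
  by rewrite genmxE; apply/sub_kermxP; rewrite BC (negPf neq_ji) raddf0.
by rewrite -mulmxA BC eqxx mulmx1 => ->; rewrite mul0mx.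
Qed.

Lemma sum_uvec : (\sum_(j < p) <<uvec (th j)>> :=: 1%:M)%MS.
Proof.
apply/eqmxP; rewrite submx1 /= -sum_ucoord; apply: summx_sub => j _.
by rewrite (sumsmx_sup j) // genmxE submxMl.
Qed.

Lemma mxdirect_uvec r (f : 'I_r -> 'I_p) : injective f ->
  mxdirect (\sum_(k < r) <<uvec (th (f k))>>)%MS.
Proof.
move=> f_inj; apply: (@mxdirect_dual _ _ (fun k => ucoord (f k))) => i j.
by rewrite uvec_ucoord (inj_eq f_inj).
Qed.

Lemma uvec_simple theta : theta \in Delta -> theta ^+ p = xi ^+ p ->
  mxsimple rG <<uvec theta>>%MS.
Proof.
move=> Dt tX; apply: (Hhom_simpleG sHG G_ind irrV).
- exact: uvecH.
- exact: uvec_neq0.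
by rewrite uvec_act // submxMl.
Qed.

(* Otherwise zeta * omega^-l != 1 for every l, and the geometric sums of the  *)
(* zeta * omega^-l would vanish, whereas they add up to p.                    *)
Lemma root_of_unity zeta : zeta \in Delta -> zeta * omega = omega * zeta ->
  zeta ^+ p = 1 -> exists l : 'I_p, zeta = omega ^+ l.
Proof.
move=> Dz cz zX.
have [/existsP[l /eqP]|/existsPn no_l] := boolP [exists l : 'I_p, zeta == omega ^+ l].
  by exists l.
have czV l : GRing.comm zeta (omega ^- l) by apply/commrV/commrX.
have sum0 (l : 'I_p) : \sum_(k < p) zeta ^+ k * (omega ^- l) ^+ k = 0.
  under eq_bigr do rewrite -(exprMn_comm _ (czV _)).
  apply: geometric_sum; first by rewrite rpredM ?rpredV ?rpredX.
    rewrite exprMn_comm // zX mul1r exprVn -exprM mulnC exprM omegaX.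
    by rewrite expr1n invr1.
  apply: contraNneq (no_l l) => z1; rewrite -[zeta](mulrVK (unitrX l omegaU)) z1.
  by rewrite mul1r.
have: \sum_(l < p) \sum_(k < p) zeta ^+ k * (omega ^- l) ^+ k = 0.
  by rewrite big1.
rewrite exchange_big /= (bigD1 (Ordinal p_gt0)) //= [X in _ + X]big1 => [|k neq].
  rewrite addr0; under eq_bigr do rewrite !expr0 mulr1.
  rewrite sumr_const card_ord => p0; have := @natr_mx_unit F n p pF0.
  by rewrite p0 unitr0.
rewrite -mulr_sumr; have := omega_sum k (Ordinal p_gt0).
rewrite (negPf neq) muln0 => omega0.
rewrite -[RHS](mulr0 (zeta ^+ k)); congr (_ * _); rewrite -[RHS]omega0.
by apply: eq_bigr => l _; rewrite mulr1 -!exprVn -!exprM mulnC.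
Qed.

Lemma uvec_iso theta theta' : theta \in Delta -> theta' \in Delta ->
    theta ^+ p = xi ^+ p -> theta' ^+ p = xi ^+ p ->
  mx_iso rG <<uvec theta>>%MS <<uvec theta'>>%MS <->
  exists d, [/\ d \in Delta, d \is a GRing.unit & theta * d = d * theta'].
Proof.
move=> Dt Dt' tX t'X; have [act act'] := (uvec_act Dt tX, uvec_act Dt' t'X).
have [nz nz'] := (uvec_neq0 theta, uvec_neq0 theta').
have [hom hom'] := (uvecH Dt, uvecH Dt').
split=> [iso|[d [Dd dU cd]]].
  exact: (mx_iso_intertwines sHG aG irrV gammaU gammaC hom hom' nz nz' act act').
exact: (intertwines_mx_iso sHG G_ind irrV gammaC hom hom' nz nz' act act' Dd).
Qed.

Variables mu nu : {poly 'M[F]_n.+1}.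
Hypotheses (mon_mu : mu \is monic) (irr_mu : irreducible_over Z mu).
Hypotheses (mon_nu : nu \is monic) (Znu : nu \is a polyOver Z).
Hypothesis numu : 'X^p - (xi ^+ p)%:P = nu * mu.
Local Notation m := (size mu).-1.

Let Zmu : mu \is a polyOver Z. Proof. by case: irr_mu. Qed.

Let polyZD f : f \is a polyOver Z -> f \is a polyOver Delta.
Proof.
by move/polyOverP=> Zf; apply/polyOverP=> i; apply: endcenter_sub.
Qed.

Let commZ f x : f \is a polyOver Z -> x \in Delta -> comm_poly f x.
Proof.
move/polyOverP=> Zf Dx; apply: comm_coef_poly => i.
by case/endcenterP: (Zf i) => _; apply.
Qed.

Let size_mu : size mu = m.+1.
Proof. by rewrite prednK // size_poly_gt0 monic_neq0. Qed.

Let m_gt0 : (0 < m)%N.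
Proof. by case: irr_mu => _; rewrite size_mu. Qed.

Let sizes : (size nu + m)%N = p.+1.
Proof.
have := size_XnsubC (xi ^+ p) p_gt0.
by rewrite numu size_Mmonic ?monic_neq0 // size_mu addnS.
Qed.

Let size_nu : size nu = (p - m).+1.
Proof.
have nu_gt0 : (0 < size nu)%N by rewrite size_poly_gt0 monic_neq0.
have le_mp : (m <= p)%N by rewrite -ltnS -sizes -[ltnLHS]add0n ltn_add2r.
by rewrite -subSn // -sizes addnK.
Qed.

Let nu_mu_th l : nu.[th l] * mu.[th l] = 0.
Proof.
rewrite -hornerM_comm; last by apply: commZ; rewrite ?th_endalg.
by rewrite -numu hornerD hornerN hornerC hornerXn th_expp subrr.
Qed.

Let nu_th_endalg l : nu.[th l] \in Delta.
Proof. by rewrite rpred_horner ?polyZD ?th_endalg. Qed.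

Let nu_th0 l : ~~ root mu (th l) -> nu.[th l] = 0.
Proof.
move=> /negPf nroot.
have := endalg_mulf_eq0 irrV (nu_th_endalg l) (nu_mu_th l).
by case=> // /rootP; rewrite nroot.
Qed.

(** The homomorphism that corresponds to the polynomial nu(s) s^i. *)
Definition wpoly i := \sum_(j < (p - m).+1) nu`_j *m b (i + j).
Definition Wpoly := (\sum_(i < m) <<wpoly i>>)%MS.

Let wpolyE i :
  wpoly i = p%:R^-1 *: \sum_(l < p) (nu.[th l] * th l ^+ i) *m uvec (th l).
Proof.
rewrite /wpoly; under eq_bigr do rewrite basis_uvec -scalemxAr mulmx_sumr.
rewrite -scaler_sumr exchange_big /=; congr (_ *: _); apply: eq_bigr => l _.
rewrite horner_coef size_nu mulr_suml mulmx_suml; apply: eq_bigr => j _.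
by rewrite mulmxA mulmxE -mulrA -exprD addnC.
Qed.

Let wpoly_sub i :
  (wpoly i <= \sum_(l < p | root mu (th l)) <<uvec (th l)>>)%MS.
Proof.
rewrite wpolyE scalemx_sub // summx_sub // => l _.
have [root_l|/nu_th0->] := boolP (root mu (th l)); last first.
  by rewrite mul0r mul0mx sub0mx.
by rewrite mulmx_sub // (sumsmx_sup l) // genmxE.
Qed.

Lemma exists_root_th : exists l : 'I_p, root mu (th l).
Proof.
apply/existsP; apply: contraT => /existsPn no_root.
have w0 : wpoly 0 = 0.
  rewrite wpolyE big1 ?scaler0 // => l _.
  by rewrite nu_th0 ?no_root // mul0r mul0mx.
(* The coordinate of [wpoly 0] at b_(p-m) is the leading coefficient 1 of nu, so [wpoly 0] cannot
   vanish. *)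
have lt_pm : (p - m < p)%N by rewrite ltn_subrL m_gt0.
pose j := Ordinal lt_pm; have := congr1 (mulmx^~ (c j)) w0; rewrite mul0mx.
rewrite /wpoly mulmx_suml big_ord_recr /= big1 => [|i _].
  rewrite add0r add0n -mulmxA (bc j j) eqxx mulmx1.
  have := monicP mon_nu; rewrite lead_coefE size_nu /= => -> /eqP.
  by rewrite oner_eq0.
have ltip := ltn_trans (ltn_ord i) lt_pm.
rewrite add0n -mulmxA (bc (Ordinal ltip) j) -val_eqE /= ltn_eqF //.
by rewrite raddf0 mulmx0.
Qed.

(* With mu = q (s - theta_l), the derivative of s^p - eta = nu mu at theta_l  *)
(* is nu(theta_l) q(theta_l), so that nu q is a unit multiple of the          *)
(* polynomial of uvec theta_l.                                                *)
Lemma uvec_sub_Wpoly (l : 'I_p) : root mu (th l) -> (uvec (th l) <= Wpoly)%MS.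
Proof.
move=> root_l; have [q Dmu] := factor_theorem _ _ root_l.
have nz_q : q != 0.
  apply: contraTneq mon_mu => q0.
  by rewrite Dmu q0 mul0r monicE lead_coef0 eq_sym oner_eq0.
have size_q : size q = m.
  by rewrite Dmu size_Mmonic ?monicXsubC // size_XsubC addn2.
have q_mu x : GRing.comm x (th l) -> mu.[x] = q.[x] * (x - th l).
  move=> cx; rewrite Dmu hornerM_comm ?hornerXsubC //.
  rewrite /comm_poly hornerXsubC mulrBr mulrBl; congr (_ - _); exact: cx.
have q0 (l' : 'I_p) : l' != l -> root mu (th l') -> q.[th l'] = 0.
  move=> neq /rootP; rewrite q_mu //.
  have U : th l' - th l \is a GRing.unit.
    apply: (endalg_unit irrV); first by rewrite rpredB ?th_endalg.
    by rewrite subr_eq0; apply: contraNneq neq => /th_inj->.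
  by move/(canRL (mulrK U)); rewrite mul0r.
have nuq : nu.[th l] * q.[th l] = th l ^+ p.-1 *+ p.
  have := congr1 (fun f : {poly 'M[F]_n.+1} => f^`().[th l]) numu.
  rewrite derivB derivC subr0 derivXn hornerMn hornerXn derivM => ->.
  rewrite hornerD [X in _ = X + _]hornerM_comm; last first.
    by apply: commZ; rewrite ?th_endalg.
  rewrite (rootP root_l) mulr0 add0r.
  have dmu : mu^`().[th l] = q.[th l].
    rewrite Dmu derivM derivXsubC mulr1 hornerD hornerM_comm.
      by rewrite hornerXsubC subrr mulr0 add0r.
    by rewrite /comm_poly hornerXsubC subrr mulr0 mul0r.
  rewrite hornerM_comm ?dmu //.
  have Dl : th l \in Delta by rewrite th_endalg.
  apply/comm_coef_poly => i; rewrite coef_deriv.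
  have /endcenterP[_ cmu] := polyOverP Zmu i.+1.
  by rewrite mulrnAl mulrnAr cmu.
pose X := \sum_(i < m) q`_i *m wpoly i.
have sXW : (X <= Wpoly)%MS.
  by apply: summx_sub => i _; rewrite mulmx_sub // (sumsmx_sup i) // genmxE.
have DX : X = p%:R^-1 *: ((q.[th l] * nu.[th l]) *m uvec (th l)).
  rewrite /X; under eq_bigr do rewrite wpolyE -scalemxAr mulmx_sumr.
  rewrite -scaler_sumr exchange_big /=; congr (_ *: _).
  have cnu k i : nu.[th k] * th k ^+ i = th k ^+ i * nu.[th k].
    apply/commr_sym/commr_sym/commrX/commr_sym.
    by apply: commZ; rewrite ?th_endalg.
  have qnu (k : 'I_p) : \sum_(i < m) q`_i *m ((nu.[th k] * th k ^+ i) *m uvec (th k))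
      = (q.[th k] * nu.[th k]) *m uvec (th k).
    rewrite (horner_coef q) size_q mulr_suml mulmx_suml; apply: eq_bigr => i _.
    by rewrite cnu mulmxA mulmxE mulrA.
  under eq_bigr do rewrite qnu.
  rewrite (bigD1 l) //= big1 ?addr0 // => k neq.
  have [root_k|/nu_th0->] := boolP (root mu (th k)); last by rewrite mulr0 mul0mx.
  by rewrite q0 // mul0r mul0mx.
have U : q.[th l] * nu.[th l] \is a GRing.unit.
  have: nu.[th l] * q.[th l] \is a GRing.unit.
    rewrite nuq -mulr_natl unitrMl ?unitrX //.
    exact: natr_mx_unit.
  by rewrite -!mulmxE !unitmx_mul andbC.
have -> : uvec (th l) = p%:R *: ((q.[th l] * nu.[th l])^-1 *m X).
  rewrite DX -scalemxAr scalerA mulfV // scale1r.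
  by rewrite mulmxA mulmxE mulVr // mul1mx.
by rewrite scalemx_sub // mulmx_sub.
Qed.

Lemma Wpoly_roots :
  (Wpoly :=: \sum_(l < p | root mu (th l)) <<uvec (th l)>>)%MS.
Proof.
apply/eqmxP/andP; split; apply/sumsmx_subP.
  by move=> i _; rewrite genmxE wpoly_sub.
by move=> l root_l; rewrite genmxE uvec_sub_Wpoly.
Qed.

(** Roots of mu are conjugate, so all summands are isomorphic. Conversely, an embedded copy of one
    of them is an eigenvector for th_l0, and its nonzero coordinates intertwine th_l0 with
    eigenvalues that are again roots of mu. *)
Lemma Wpoly_component :
  exists2 M, mxsimple rG M & (Wpoly :=: component_mx rG M)%MS.
Proof.
have [l0 root_l0] := exists_root_th.
have simM := uvec_simple (th_endalg l0) (th_expp l0).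
exists <<uvec (th l0)>>%MS => //.
apply: eqmx_trans Wpoly_roots _; apply/eqmxP/andP; split.
  apply/sumsmx_subP=> l root_l; apply: mx_iso_component => //.
  apply/uvec_iso; rewrite ?th_endalg ?th_expp //.
  exact: (conjugate_roots irrV (th_endalg l0) mon_mu irr_mu root_l0
    (th_endalg l) root_l).
have [I [W isoW ->]] := component_mx_def simM.
apply/sumsmx_subP=> i _; case: (isoW i) => f _; rewrite genmxE => /hom_mxP homf defW.
pose X := uvec (th l0) *m f.
have XW : (X :=: W i)%MS.
  by apply: eqmx_trans defW; apply/eqmxMr/eqmx_sym/genmxE.
have hX : Hhom X.
  move=> h Hh; rewrite mulmxA uvecH ?th_endalg // homf //.
  exact: (subsetP sHG).
have XA : X *m rG a = gamma *m th l0 *m X.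
  rewrite -homf // uvec_act ?th_endalg ?th_expp //; exact/esym/mulmxA.
rewrite -XW (uvec_expand X); apply: summx_sub => l _.
pose x (k : nat) := X *m ucoord k.
have Dx (k : 'I_p) : x k \in Delta.
  exact: (Hhom_coord (b := fun l => uvec (th l)) (fun k => uvecH (th_endalg k))
    uvec_ucoord sum_ucoord k hX).
have xth : x l * th l = th l0 * x l.
  have E1 : \sum_(k < p) (gamma * (x k * th k)) *m uvec (th k)
      = \sum_(k < p) (gamma * (th l0 * x k)) *m uvec (th k).
    transitivity (X *m rG a).
      rewrite [X in X *m _]uvec_expand mulmx_suml; apply: eq_bigr => k _.
      rewrite -(mulmxA _ _ (rG a)) uvec_act ?th_endalg ?th_expp // -/(x k).
      rewrite (mulmxA (x k)) (mulmxA (x k)) !mulmxE.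
      by rewrite (gammaC (Dx k)) mulrA.
    rewrite XA {1}[X in _ *m X]uvec_expand mulmx_sumr; apply: eq_bigr => k _.
    by rewrite -/(x k) (mulmxA _ (x k)) !mulmxE -mulrA.
  have := congr1 (mulmx^~ (ucoord l)) E1.
  rewrite (sum_uvec_coord (fun k => gamma * (x k * th k))).
  by rewrite (sum_uvec_coord (fun k => gamma * (th l0 * x k))) => /(mulrI gammaU).
rewrite -/(x l); have [->|nz_x] := eqVneq (x l) 0; first by rewrite mul0mx sub0mx.
rewrite mulmx_sub // (sumsmx_sup l) ?genmxE //.
have xU := endalg_unit irrV (Dx l) nz_x.
(* As the coefficients of mu are central, x_l th_l = th_l0 x_l gives x_l mu(th_l) = mu(th_l0) x_l =
   0. *)
apply/rootP/(mulrI xU); rewrite mulr0 -[RHS](mul0r (x l)) -(rootP root_l0).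
rewrite !horner_coef mulr_sumr mulr_suml; apply: eq_bigr => k _.
have /endcenterP[_ cmu] := polyOverP Zmu k.
rewrite mulrA -cmu // -!mulrA; congr (_ * _).
elim: (k : nat) => [|e IHe]; first by rewrite !expr0 mulr1 mul1r.
by rewrite exprSr mulrA IHe -mulrA xth mulrA -exprSr.
Qed.

(** The centralizer of omega in Delta is a division ring containing Z, xi and omega, hence also x.
    So xi^-1 x is a p-th root of unity commuting with omega, and [root_of_unity] applies. *)
Lemma in_adjoin2_root x : in_adjoin2 Z xi omega x -> root mu x ->
  exists l : 'I_p, x = th l.
Proof.
pose S := [pred z : 'M[F]_n.+1 | (z \in Delta) && (z * omega == omega * z)].
have S_div : divring_closed S.
  split=> [|y z /andP[Dy /eqP cy] /andP[Dz /eqP cz]|].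
  - by rewrite inE rpred1 mul1r mulr1 eqxx.
  - by rewrite inE rpredB //= mulrBl mulrBr cy cz.
  move=> y z /andP[Dy /eqP cy] /andP[Dz /eqP cz].
  rewrite inE rpred_div //= -mulrA; apply/eqP.
  by rewrite -(commrV (esym cz : GRing.comm omega z)) !mulrA cy.
have sZS : {subset Z <= S}.
  move=> z /endcenterP[Dz cz]; rewrite inE Dz /=; apply/eqP.
  exact: cz.
have xiS : xi \in S by apply: sZS.
have omS : omega \in S by rewrite inE omegaD /=.
move=> /(_ S S_div sZS xiS omS) /andP[Dx /eqP cx] root_x.
have xX : x ^+ p = xi ^+ p.
  have : ('X^p - (xi ^+ p)%:P).[x] = x ^+ p - xi ^+ p.
    by rewrite hornerD hornerN hornerC hornerXn.
  move=> /esym Dx0; apply/eqP; rewrite -subr_eq0 Dx0 numu.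
  rewrite hornerM_comm; last exact: commZ.
  by rewrite (rootP root_x) mulr0.
have [|||l Dl] := @root_of_unity (xi^-1 * x).
- by rewrite rpredM ?rpredV.
- rewrite -mulrA cx !mulrA; congr (_ * _).
  by apply/esym/commrV/commr_sym/xiC.
- rewrite exprMn_comm; last by apply/commr_sym/commrV/commr_sym/xiC.
  by rewrite xX exprVn mulVr ?unitrX.
by exists l; rewrite -Dl mulrA mulrV // mul1r.
Qed.

Lemma th_in_adjoin2 l : in_adjoin2 Z xi omega (th l).
Proof.
move=> S [S1 _ S_div] _ xiS omS.
have SV z : z \in S -> z^-1 \in S by move=> Sz; rewrite -[z^-1]mul1r S_div.
have SM y z : y \in S -> z \in S -> y * z \in S.
  by move=> Sy Sz; rewrite -[z]invrK S_div ?SV.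
apply: (SM) => //; elim: l => [|l IHl]; first by rewrite expr0.
by rewrite exprS SM.
Qed.

Lemma Wpoly_decomposition : exists (r : nat) (theta : 'I_r -> 'M[F]_n.+1),
  [/\ injective theta,
      forall x, (exists k, x = theta k) <-> in_adjoin2 Z xi omega x /\ root mu x,
      (Wpoly :=: \sum_(k < r) <<uvec (theta k)>>)%MS
    & mxdirect (\sum_(k < r) <<uvec (theta k)>>)%MS].
Proof.
pose I := [set l : 'I_p | root mu (th l)].
exists #|I|, (fun k : 'I_#|I| => th (enum_val k : 'I_p)); split.
- by move=> k l /th_inj/enum_val_inj.
- move=> x; split=> [[k ->]|[adj_x root_x]].
    by split; [exact: th_in_adjoin2 | move: (enum_valP k); rewrite inE].
  have [l Dx] := in_adjoin2_root adj_x root_x.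
  have Il : l \in I by rewrite inE -Dx.
  by exists (enum_rank_in Il l); rewrite enum_rankK_in.
- apply: eqmx_trans Wpoly_roots _.
  rewrite -(big_enum_val (fun l : 'I_p => <<uvec (th l)>>%MS)) /=.
  by under [X in (_ :=: X)%MS]eq_bigl do rewrite inE.
exact: mxdirect_uvec enum_val_inj.
Qed.

End Ordinary.

(** * The homomorphisms eps^i alpha^-i a^i realize the abstract basis *)

Section TwistedBasis.

Variables (F : fieldType) (gT : finGroupType) (G H : {group gT}).
Hypothesis nHG : (H <| G)%g.
Variable p : nat.
Hypotheses (p_pr : prime p) (indexHG : #|G : H|%g = p).
Variable a : gT.
Hypotheses (aG : a \in G) (aNH : a \notin H).
Variables (n : nat) (sigma : mx_representation F H n.+1).
Variable alpha : 'M[F]_n.+1.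
Hypothesis alphaU : alpha \is a GRing.unit.
Hypothesis alphaP : forall h, h \in H ->
  sigma (a * h * a^-1)%g = alpha * sigma h * alpha^-1.
Variable eps : 'M[F]_n.+1.
Hypotheses (epsD : eps \in endalg sigma) (epsU : eps \is a GRing.unit).
Hypothesis epsP : forall delta, delta \in endalg sigma ->
  alpha^-1 * delta * alpha = eps^-1 * delta * eps.
Let sHG := normal_sub nHG.
Local Notation Vup := (ind_repr sHG sigma).
Local Notation N := (ind_dim G sigma).
Local Notation va i := (tens G sigma (a ^+ i)%g).

Definition twist i : 'M[F]_n.+1 := eps ^+ i * alpha ^- i.
Definition tbasis i : 'M[F]_(n.+1, N) := twist i *m va i.
Definition tcoord i : 'M[F]_(N, n.+1) := ind_coord G a sigma i *m (twist i)^-1.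

Lemma twist_unit i : twist i \is a GRing.unit.
Proof. by rewrite unitrMl ?unitrV ?unitrX. Qed.

Lemma tbasis_coord (i j : 'I_p) : tbasis i *m tcoord j = (i == j)%:R%:M.
Proof.
rewrite /tbasis /tcoord -mulmxA (mulmxA (va i)) (tens_coord nHG p_pr) //.
rewrite mul_scalar_mx -scalemxAr; have [->|_] := eqVneq i j.
  by rewrite scale1r mulmxE mulrV ?twist_unit.
by rewrite scale0r raddf0.
Qed.

Lemma sum_tcoord : \sum_(i < p) tcoord i *m tbasis i = 1%:M.
Proof.
rewrite -(sum_coord_tens nHG p_pr indexHG aG aNH sigma).
apply: eq_bigr => i _; rewrite /tcoord -mulmxA (mulmxA _ (twist i)) mulmxE.
by rewrite mulVr ?twist_unit // mul1mx.
Qed.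

Let Na : a \in 'N(H)%g := subsetP (normal_norm nHG) a aG.

Lemma sigmaJ i h : h \in H ->
  sigma (a ^+ i * h * a ^- i)%g = alpha ^+ i * sigma h * alpha ^- i.
Proof.
elim: i h => [|i IHi] h Hh.
  by rewrite !expg0 invg1 mul1g mulg1 !expr0 invr1 mulr1 mul1r.
have -> : (a ^+ i.+1 * h * a ^- i.+1 = a ^+ i * (a * h * a^-1) * a ^- i)%g.
  by rewrite expgSr invMg !mulgA.
rewrite IHi; last first.
  have : (h ^ (a^-1) \in H)%g by rewrite memJ_norm ?groupV.
  by rewrite conjgE invgK mulgA.
by rewrite alphaP // exprSr invrM ?unitrX // !mulrA.
Qed.

Lemma tbasisH i : Hhom sigma Vup (tbasis i).
Proof.
move=> h Hh; have Gh := subsetP sHG h Hh.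
rewrite /tbasis -mulmxA tensM ?groupX //.
have HJ : (a ^+ i * h * a ^- i \in H)%g.
  have : (h ^ (a ^- i) \in H)%g by rewrite memJ_norm ?groupV ?groupX.
  by rewrite conjgE invgK mulgA.
have -> : (a ^+ i * h = (a ^+ i * h * a ^- i) * a ^+ i)%g by rewrite mulgKV.
rewrite tens_midlin ?groupX // sigmaJ //.
rewrite (mulmxA (sigma h)) (mulmxA (twist i)) !mulmxE; congr (_ *m _).
rewrite /twist !mulrA mulrVK ?unitrX //; congr (_ * _).
have /endalgP cD : eps ^+ i \in endalg sigma by rewrite rpredX.
by apply/esym/cD.
Qed.

Definition gam := alpha * eps^-1.

Lemma gam_unit : gam \is a GRing.unit.
Proof. by rewrite unitrMl ?unitrV. Qed.

Lemma gam_comm f : f \in endalg sigma -> f * gam = gam * f.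
Proof.
move=> Df; have := epsP Df; move/(congr1 (fun x => alpha * x * eps^-1)).
by rewrite /gam !mulrA mulrV // mul1r mulrK // => ->.
Qed.

Lemma tbasis_act i : tbasis i *m Vup a = gam *m tbasis i.+1.
Proof.
(* The hypothesis [epsP] taken at eps itself. *)
have ea : alpha * eps = eps * alpha.
  have := epsP epsD; rewrite mulVr // mul1r => /(congr1 (fun x => alpha * x)).
  by rewrite !mulrA mulrV // mul1r => ->.
rewrite /tbasis -mulmxA tensM ?groupX // -expgSr (mulmxA gam) mulmxE.
congr (_ *m _); rewrite /twist /gam (exprS eps) (exprSr alpha) invrM ?unitrX //.
have cae : GRing.comm alpha (eps ^+ i) by apply: commrX.
by rewrite !mulrA mulrVK // cae mulrK.
Qed.

Lemma expg_index_mem : (a ^+ p \in H)%g.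
Proof.
apply: coset_idr; first exact: groupX.
rewrite morphX //= -indexHG -card_quotient ?normal_norm //.
by rewrite expg_cardG // mem_quotient.
Qed.

(** As a^p lies in H, it crosses the tensor sign and acts on V through sigma. *)
Lemma tbasis_p lambda : lambda = alpha ^- p * sigma (a ^+ p)%g ->
  tbasis p = (eps ^+ p * lambda) *m tbasis 0.
Proof.
move=> ->; have HapX := expg_index_mem.
rewrite /tbasis /twist !expr0 invr1 mulr1 mul1mx.
by rewrite -[(a ^+ p)%g in LHS]mulg1 tens_midlin // (mulmxA (_ * _)) mulmxE mulrA.
Qed.

Lemma Ubasis_tbasis theta :
  Ubasis G sigma p a alpha eps theta = uvec p tbasis theta.
Proof.
by apply: eq_bigr => i _; rewrite /tbasis (mulmxA _ (twist _)) mulmxE /twist mulrA.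
Qed.

Lemma Wsub_tbasis mu nu :
  Wsub G sigma p a alpha eps mu nu = Wpoly p tbasis mu nu.
Proof.
apply: eq_bigr => i _; congr (<<_>>%MS); apply: eq_bigr => j _.
by rewrite /tbasis (mulmxA _ (twist _)) mulmxE /twist mulrA.
Qed.

Lemma Wseries_tbasis xi k :
  Wseries G sigma p a alpha eps xi k = wsum p tbasis xi k.
Proof.
apply: eq_bigr => i _; congr (<<_>>%MS); apply: eq_bigr => j _.
by rewrite /tbasis (mulmxA _ (twist _)) mulmxE /twist !mulrA.
Qed.

End TwistedBasis.

(** * Roots of unity in characteristic p, and the assembly of the two cases *)

(** By Frobenius (omega - 1)^p = omega^p - 1 = 0, and Delta has no nonzero nilpotent element. *)
Lemma endalg_unity_pchar (F : fieldType) (gT : finGroupType) (H : {group gT})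
    (n : nat) (rV : mx_representation F H n.+1) p omega :
    mx_irreducible rV -> p \in [pchar F] -> omega \in endalg rV ->
  omega ^+ p = 1 -> omega = 1.
Proof.
move=> irrV pF Dom omX.
have pM : p \in [pchar 'M[F]_n.+1].
  rewrite inE (pcharf_prime pF) /= -scaler_nat (pcharf0 pF) scale0r //.
have D1 : omega - 1 \in endalg rV by rewrite rpredB ?rpred1.
have om0 : (omega - 1) ^+ p = 0.
  have := pFrobenius_autB_comm pM (commr1 omega).
  by rewrite !pFrobenius_autE omX expr1n subrr.
apply/eqP; rewrite -subr_eq0; apply/wlog_neg => nz.
have := unitrX p (endalg_unit irrV D1 nz).
by rewrite om0 unitr0.
Qed.

Lemma eq_mxdirect_sums (F : fieldType) (N r : nat) (A B : 'I_r -> 'M[F]_N) :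
  A =1 B -> mxdirect (\sum_(i < r) A i)%MS -> mxdirect (\sum_(i < r) B i)%MS.
Proof.
move=> eqAB /mxdirect_sumsP dxA; apply/mxdirect_sumsP=> i _.
transitivity (A i :&: \sum_(j | true && (j != i)) A j)%MS; last exact: dxA.
rewrite -eqAB; congr (_ :&: _)%MS; by apply: eq_bigr => j _; rewrite eqAB.
Qed.

Theorem theorem8 (F : fieldType) (gT : finGroupType) (G H : {group gT})
    (nHG : (H <| G)%g) (p : nat) (p_pr : prime p) (indexHG : #|G : H|%g = p)
    (a : gT) (aG : a \in G) (aNH : a \notin H)
    (n : nat) (sigma : mx_representation F H n.+1)
    (irrV : mx_irreducible sigma) (stabV : G_stable G sigma)
    (alpha : 'M[F]_n.+1) (alphaU : alpha \is a GRing.unit)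
    (alphaP : forall h, h \in H ->
       sigma (a * h * a^-1)%g = alpha * sigma h * alpha^-1)
    (lambda : 'M[F]_n.+1) (lambdaE : lambda = alpha ^- p * sigma (a ^+ p)%g)
    (eps : 'M[F]_n.+1) (epsD : eps \in endalg sigma)
    (epsU : eps \is a GRing.unit)
    (epsP : forall delta, delta \in endalg sigma ->
       alpha^-1 * delta * alpha = eps^-1 * delta * eps)
    (eta : 'M[F]_n.+1) (etaE : eta = eps ^+ p * lambda)
    (xi omega : 'M[F]_n.+1)
    (xiD : xi \in endalg sigma) (omegaD : omega \in endalg sigma)
    (xiX : xi ^+ p = eta) (omegaX : omega ^+ p = 1)
    (xiZ0 : [pchar F] =i pred0 -> xi \in endcenter sigma) :
  let sHG := normal_sub nHG in
  let Delta := endalg sigma in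
  let Z := endcenter sigma in
  let Vup := ind_repr sHG sigma in
  let e' := Ubasis G sigma p a alpha eps in
  let U := Usub G sigma p a alpha eps in
  let Wmu := Wsub G sigma p a alpha eps in
  let W := Wseries G sigma p a alpha eps xi in
  [/\ xi \in Z,
   (p \notin [pchar F] -> omega != 1 ->
    [/\ [/\ (\sum_(j < p) U (xi * omega ^+ j)%R :=: 1%:M)%MS,
            mxdirect (\sum_(j < p) U (xi * omega ^+ j)%R)%MS
          & forall j : 'I_p, mxsimple Vup (U (xi * omega ^+ j)%R)],
        forall omega', omega' \in Delta -> omega' ^+ p = 1 ->
          mx_iso Vup (U (xi * omega)%R) (U (xi * omega')%R) <->
          (exists delta, [/\ delta \in Delta, delta \is a GRing.unit
                           & omega' = delta^-1 * omega * delta]),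
        forall mu nu : {poly 'M[F]_n.+1},
          mu \is monic -> irreducible_over Z mu ->
          nu \is monic -> nu \is a polyOver Z ->
          'X^p - eta%:P = nu * mu ->
          (exists2 M, mxsimple Vup M & (Wmu mu nu :=: component_mx Vup M)%MS)
          /\ (exists (r : nat) (theta : 'I_r -> 'M[F]_n.+1),
               [/\ injective theta,
                   forall x, (exists k, x = theta k) <->
                     in_adjoin2 Z xi omega x /\ root mu x,
                   (Wmu mu nu :=: \sum_(k < r) U (theta k))%MS
                 & mxdirect (\sum_(k < r) U (theta k))%MS])
      & forall (j : nat) (theta := xi * omega ^+ j),
          exists rho : mx_representation F G n.+1,
            [/\ affords Vup (e' theta) rho,
                rho a = alpha * eps^-1 * theta,
                forall h, h \in H -> rho h = sigma h
              & forall f, f \in endalg rho <->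
                  f \in Delta /\ f * theta = theta * f]])
   & (p \in [pchar F] ->
    [/\ omega = 1,
        uniserial Vup,
        [/\ W 0%N = 0,
            mx_composition_series Vup [seq W k | k <- iota 1 p],
            (W p :=: 1%:M)%MS
          & forall Us, mx_composition_series Vup Us ->
              (last 0 Us :=: 1%:M)%MS ->
              size Us = p /\
              forall k, (k < p)%N -> (Us`_k :=: W k.+1)%MS],
        forall k, (1 <= k <= p)%N ->
          exists (modU : mxmodule Vup (U xi)) (modW' : mxmodule Vup (W k.-1))
                 (modW : mxmodule Vup (W k)),
            mx_rsim (section_repr modW' modW) (submod_repr modU)
      & exists2 rho : mx_representation F G n.+1,
          affords Vup (e' xi) rho
          & forall f, f \in endalg rho <-> f \in Delta])].
Proof.
move=> sHG Delta Z Vup e' U Wmu W.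
have xiZ : xi \in Z.
  have [char0|nchar0] := classic ([pchar F] =i pred0); first exact: xiZ0.
  have [q qF] : exists q, q \in [pchar F].
    apply: NNPP => no_q; apply: nchar0 => q; apply/negP => qF.
    by apply: no_q; exists q.
  apply/endcenterP; split=> // f Df.
  move: xiD Df; rewrite !inE !memmx_cent_envelop.
  exact: pchar_centgmx_comm irrV q qF xi f.
have p_gt0 := prime_gt0 p_pr.
have xiU : xi \is a GRing.unit.
  have HapX := expg_index_mem nHG indexHG aG.
  rewrite -(unitrX_pos xi p_gt0) xiX etaE lambdaE.
  by rewrite !unitrMl ?unitrX ?unitrV ?unitrX // [_ \is a _]repr_mx_unit.
pose b := tbasis G a sigma alpha eps; pose c := tcoord G a sigma alpha eps.
pose g := gam alpha eps.
have gU : g \is a GRing.unit by exact: gam_unit.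
have gC f : f \in Delta -> f * g = g * f.
  exact: (gam_comm (sigma := sigma) alphaU epsU epsP).
have G_ind := @normal_cyclic_ind _ _ _ nHG _ p_pr indexHG _ aG aNH.
have bH i : Hhom sigma Vup (b i).
  exact: (tbasisH nHG aG alphaU alphaP epsD).
have bS i : b i *m Vup a = g *m b i.+1.
  exact: (tbasis_act nHG aG alphaU epsD epsU epsP).
have bc (i j : 'I_p) : b i *m c j = (i == j)%:R%:M.
  exact: (tbasis_coord nHG p_pr indexHG aG aNH sigma alphaU epsU i j).
have cb : \sum_(i < p) c i *m b i = 1%:M.
  exact: (sum_tcoord nHG p_pr indexHG aG aNH sigma alphaU epsU).
have bp : b p = xi ^+ p *m b 0%N.
  by rewrite xiX etaE; apply: (tbasis_p nHG indexHG aG).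
have e'E theta : e' theta = uvec p b theta by exact: Ubasis_tbasis.
have UE theta : U theta = <<uvec p b theta>>%MS by rewrite -e'E.
have WE k : W k = wsum p b xi k by exact: Wseries_tbasis.
have u_act theta (Dt : theta \in Delta) (tX : theta ^+ p = xi ^+ p) :=
  uvec_act gC p_pr bS xiU bp Dt tX.
have u_hom theta (Dt : theta \in Delta) := uvecH p bH Dt.
have u_neq0 theta := uvec_neq0 p_pr bc theta.
split=> // [pF omega1|pF].
  have thD j : xi * omega ^+ j \in Delta by exact: th_endalg.
  have thX j : (xi * omega ^+ j) ^+ p = xi ^+ p.
    exact: (th_expp xiZ omegaD omegaX).
  split.
  - split.
    + under eq_bigr do rewrite UE.
      exact: (sum_uvec irrV p_pr cb xiZ xiU omegaD omegaX omega1 pF).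
    + have dxU := mxdirect_uvec irrV p_pr bc xiZ xiU omegaD omegaX omega1 pF
        (@inj_id 'I_p).
      by apply: eq_mxdirect_sums dxU => j; rewrite UE.
    move=> j; rewrite UE.
    exact: (uvec_simple sHG G_ind irrV gC p_pr bH bS bc xiU bp (thD j) (thX j)).
  - move=> omega' Dom' om'X; rewrite !UE.
    have th1X : (xi * omega) ^+ p = xi ^+ p by rewrite -[omega]expr1.
    have th'X : (xi * omega') ^+ p = xi ^+ p.
      by rewrite -[omega']expr1; apply: (th_expp xiZ Dom' om'X).
    have Dxom : xi * omega \in Delta by rewrite rpredM.
    have Dxom' : xi * omega' \in Delta by rewrite rpredM.
    have := uvec_iso sHG aG G_ind irrV gU gC p_pr bH bS bc xiU bp
      Dxom Dxom' th1X th'X.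
    move=> isoE; apply: (iff_trans isoE); case/endcenterP: xiZ => _ xiC.
    split=> -[d [Dd dU cd]]; exists d; split=> //.
      rewrite -mulrA; apply: (canRL (mulKr dU)); apply: (mulrI xiU).
      by rewrite !mulrA cd mulrA xiC.
    by rewrite cd (mulrA d) -xiC // -!mulrA (mulrA d) mulrV // mul1r.
  - move=> mu nu mon_mu irr_mu mon_nu Znu numu; rewrite -xiX in numu.
    have -> : Wmu mu nu = Wpoly p b mu nu by exact: Wsub_tbasis.
    split.
      exact: (Wpoly_component sHG aG G_ind irrV gU gC p_pr bH bS bc cb xiZ xiU bp
        omegaD omegaX omega1 pF mon_mu irr_mu mon_nu Znu numu).
    have [r [theta [theta_inj thetaP sumW dxW]]] :=
      Wpoly_decomposition irrV gU gC p_pr bS bc cb xiZ xiU bp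
        omegaD omegaX omega1 pF mon_mu irr_mu mon_nu Znu numu.
    exists r, theta; split=> //; first by under eq_bigr do rewrite UE.
    by apply: eq_mxdirect_sums dxW => k; rewrite UE.
  - move=> j theta; rewrite e'E.
    have [rho [rhoA rho_a rhoH]] := extension_exists sHG aG G_ind irrV
      (u_hom _ (thD j)) (u_neq0 _) (u_act _ (thD j) (thX j)).
    exists rho; split=> // f.
    exact: (extension_endalg sHG aG G_ind gU gC rho_a rhoH).
have omega1 : omega = 1 by apply: endalg_unity_pchar irrV pF omegaD omegaX.
have WmodW k : (k <= p)%N -> mxmodule Vup (W k).
  by rewrite WE; apply: (wsum_module sHG aG G_ind gU gC p_pr bH bS xiZ xiU bp pF).
have [rho [rhoA rho_a rhoH]] := extension_exists sHG aG G_ind irrV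
  (u_hom _ xiD) (u_neq0 _) (u_act _ xiD (erefl _)).
split=> //.
- exact: (wsum_uniserial sHG aG irrV gU gC p_pr bH bS bc cb xiZ xiU bp pF).
- split.
  + by rewrite WE wsum0.
  + under eq_map do rewrite WE.
    exact: (wsum_composition_series sHG aG G_ind irrV gU gC p_pr bH bS bc cb
      xiZ xiU bp pF).
  + rewrite WE; apply/eqmxP; rewrite submx1.
    exact: (wsum_full sHG irrV p_pr bH bc cb xiZ xiU pF).
  move=> Us compU lastU.
  have size_U := composition_series_size sHG aG G_ind irrV gU gC p_pr bH bS bc cb
    xiZ xiU bp pF compU lastU.
  split=> // k lt_kp; rewrite WE; rewrite -size_U in lt_kp.
  by case: (composition_series_wsum sHG aG G_ind irrV gU gC p_pr bH bS bc cb
    xiZ xiU bp pF compU lt_kp).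
- move=> [//|k] /= lt_kp; have modU : mxmodule Vup (U xi).
    rewrite UE (eqmx_module _ (genmxE _)).
    apply: (Hhom_module G_ind (u_hom _ xiD)).
    by rewrite u_act // submxMl.
  exists modU, (WmodW k (ltnW lt_kp)), (WmodW k.+1 lt_kp).
  (* Both the factor W_k / W_(k-1) and U(xi) are compared with [rho], the extension of sigma in
     which [a] acts by gamma xi. *)
  apply: (@mx_rsim_trans _ _ _ _ _ _ _ rho); last first.
    apply: affords_rsim_submod rhoA _.
    by rewrite UE; apply: genmxE.
  apply: mx_rsim_sym.
  apply: (extension_rsim_section sHG aG G_ind irrV rho_a rhoH (Y := wvec p b xi k.+1)).
  + exact: (wvecH p bH xiZ).
  + rewrite !WE wsumS; apply: adds_eqmx (eqmx_refl _) (genmxE _).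
  + by rewrite WE; apply: (wvec_notin p_pr bc xiU pF).
  by rewrite WE; apply: (wvec_act_sub gU gC p_pr bS xiZ xiU bp pF).
exists rho => [|f]; first by rewrite e'E.
apply: iff_trans (extension_endalg sHG aG G_ind gU gC rho_a rhoH f) _.
split=> [[]|Df] //; split=> //; case/endcenterP: xiZ => _ xiC.
by rewrite xiC.
Qed.
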